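(* If $U_1\in O_\epsilon(U_{m1})$ and $U_2,U_3\in O_\epsilon(U_{m2})$ with $$\{U_1,U_2\}=(0,\sigma_2,\sigma_3,\alpha_4),\qquad \{U_2,U_3\}=(\beta_1,\beta_2,\beta_3,0),$$ then $\{U_1,U_3\}=(\delta_1,\sigma_2',\sigma_3',\delta_4)$ with $$\delta_1=K_{va1}\beta_1+O(1)\Delta'',\qquad \sigma_2'=\sigma_2+\beta_2+K_{va2}\beta_1+O(1)\Delta'',$$ $$\sigma_3'=\sigma_3+\beta_3+K_{va3}\beta_1+O(1)\Delta'',\qquad \delta_4=\alpha_4+K_{va4}\beta_1+O(1)\Delta'',$$ and $$\Delta''=|\alpha_4|(|\beta_2|+|\beta_3|),\qquad \sum_{j=1}^3|K_{vaj}|\le M,\qquad |K_{va4}|<1.$$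
   Context: Fix $\gamma>1$. For $U=(u,v,p,\rho)$ with $p,\rho>0$ put $c=\sqrt{\gamma p/\rho}$, $h=\frac{\gamma p}{(\gamma-1)\rho}$, $$W(U)=\big(\rho u,\rho u^2+p,\rho uv,\rho u(h+\tfrac{u^2+v^2}{2})\big),\quad H(U)=\big(\rho v,\rho uv,\rho v^2+p,\rho v(h+\tfrac{u^2+v^2}{2})\big).$$ The steady full Euler system is $W(U)_x+H(U)_y=0$. For $u>c$ its eigenvalues are $\lambda_j=\frac{uv+(-1)^jc\sqrt{u^2+v^2-c^2}}{u^2-c^2}$ ($j=1,4$), $\lambda_2=\lambda_3=v/u$, with eigenvectors $\mathbf r_j=\kappa_j(-\lambda_j,1,\rho(\lambda_ju-v),\rho(\lambda_ju-v)/c^2)^\top$ ($j=1,4$, $\kappa_j$ chosen so that $\mathbf r_j\cdot\nabla\lambda_j=1$), $\mathbf r_2=(u,v,0,0)^\top$, $\mathbf r_3=(0,0,0,\rho)^\top$. Elementary waves. For $j=1,4$, $\alpha\mapsto\Phi_j(\alpha;U)$ is a fixed (Lax) $C^2$ parametrization of the states that lie above a state $U$ and are connected to it by a $j$-rarefaction wave ($\alpha>0$) or by a $j$-shock ($\alpha<0$) satisfying the Rankine–Hugoniot conditions $s(W(U_+)-W(U_-))=H(U_+)-H(U_-)$ and $\lambda_j(U_+)<s<\lambda_j(U_-)$ ($-$ below, $+$ above), with $\Phi_j(0;U)=U$, $\partial_\alpha\Phi_j(0;U)=\mathbf r_j(U)$. Vortex sheets and entropy waves: $\Phi_2(\alpha;U)=(ue^\alpha,ve^\alpha,p,\rho)$,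 $\Phi_3(\alpha;U)=(u,v,p,\rho e^\alpha)$. Put $\Phi(\alpha_4,\alpha_3,\alpha_2,\alpha_1;U)=\Phi_4(\alpha_4;\Phi_3(\alpha_3;\Phi_2(\alpha_2;\Phi_1(\alpha_1;U))))$ and $G_{2,3}(\sigma_3,\sigma_2;U)=\Phi_3(\sigma_3;\Phi_2(\sigma_2;U))$. Background states. $U_{m1}=(u_{m1},0,p_{m1},\rho_{m1})$ and $U_{m2}=(u_{m2},0,p_{m2},\rho_{m2})$ are fixed, both with $u>c$, connected by a strong combined vortex sheet/entropy wave: $U_{m2}=G_{2,3}(\sigma_{30},\sigma_{20};U_{m1})$. Notation. For two states near the same background state, $\{U,V\}=(\alpha_1,\alpha_2,\alpha_3,\alpha_4)$ means $V=\Phi(\alpha_4,\alpha_3,\alpha_2,\alpha_1;U)$ with small $\alpha_i$. For $U$ near $U_{m1}$ and $V$ near $U_{m2}$, $\{U,V\}=(\delta_1,\sigma_2,\sigma_3,\delta_4)$ means $V=\Phi_4(\delta_4;G_{2,3}(\sigma_3,\sigma_2;\Phi_1(\delta_1;U)))$ with $\delta_1,\delta_4$ near $0$ and $(\sigma_2,\sigma_3)$ near $(\sigma_{20},\sigma_{30})$. $O_\epsilon(\cdot)$ denotes sufficiently small neighborhoods, $M>0$ a large constant, both depending only on the system and the background states; $O(1)$ denotes a quantity bounded in absolute value by $M$. The coefficients $K$ may depend on the given states and wave strengths. *)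

(* Defs.v *)
(* MathComp-Analysis; the reals are an arbitrary [R : realType]. *)
From mathcomp Require Import all_boot all_order all_algebra.
From mathcomp Require Import all_classical all_reals all_analysis.

Set Implicit Arguments.
Unset Strict Implicit.
Unset Printing Implicit Defensive.

Import Order.TTheory GRing.Theory Num.Theory.
Import numFieldNormedType.Exports.
Local Open Scope classical_set_scope.
Local Open Scope ring_scope.

Section C2.
Context {R : realType} {V W : normedModType R}.

(* For open A and finite-dimensional V, where continuity of ['d f] in the
   operator norm is the same as pointwise continuity. *)
Definition C1_on (A : set V) (f : V -> W) : Prop :=
  forall x, A x ->
    differentiable f x /\ forall v, {for x, continuous (fun y => 'd f y v)}.

Definition C2_on (A : set V) (f : V -> W) : Prop :=
  C1_on A f /\ forall v, C1_on A (fun y => 'd f y v).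

End C2.

Section Euler.
Context {R : realType}.

(* A state is U = (u, v, p, rho); the topology is that of the sup norm. *)
Notation state := 'rV[R]_4.

Definition mkstate (a b c d : R) : state :=
  \row_(i < 4) nth 0 [:: a; b; c; d] i.

Definition ucomp (U : state) : R := U 0 (inord 0).
Definition vcomp (U : state) : R := U 0 (inord 1).
Definition pcomp (U : state) : R := U 0 (inord 2).
Definition rhocomp (U : state) : R := U 0 (inord 3).

Definition Phi2 (a : R) (U : state) : state :=
  mkstate (ucomp U * expR a) (vcomp U * expR a) (pcomp U) (rhocomp U).

Definition Phi3 (a : R) (U : state) : state :=
  mkstate (ucomp U) (vcomp U) (pcomp U) (rhocomp U * expR a).

Definition G23 (s3 s2 : R) (U : state) : state := Phi3 s3 (Phi2 s2 U).

Variable gamma : R.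

Definition sound (U : state) : R := Num.sqrt (gamma * pcomp U / rhocomp U).

Definition enthalpy (U : state) : R :=
  gamma * pcomp U / ((gamma - 1) * rhocomp U).

Definition Wflux (U : state) : state :=
  let u := ucomp U in let v := vcomp U in
  let p := pcomp U in let rho := rhocomp U in
  mkstate (rho * u) (rho * u ^+ 2 + p) (rho * u * v)
          (rho * u * (enthalpy U + (u ^+ 2 + v ^+ 2) / 2)).

Definition Hflux (U : state) : state :=
  let u := ucomp U in let v := vcomp U in
  let p := pcomp U in let rho := rhocomp U in
  mkstate (rho * v) (rho * u * v) (rho * v ^+ 2 + p)
          (rho * v * (enthalpy U + (u ^+ 2 + v ^+ 2) / 2)).

Definition supersonic (U : state) : Prop :=
  [/\ 0 < pcomp U, 0 < rhocomp U & sound U < ucomp U].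

(* [lambda], [rdir], [rvec], [rarefaction], [shock] and [lax_curve] are only
   meant for the genuinely nonlinear families j = 1 and j = 4. *)
Definition lambda (j : nat) (U : state) : R :=
  let u := ucomp U in let v := vcomp U in let c := sound U in
  (u * v + (-1) ^+ j * c * Num.sqrt (u ^+ 2 + v ^+ 2 - c ^+ 2))
    / (u ^+ 2 - c ^+ 2).

Definition rdir (j : nat) (U : state) : state :=
  let u := ucomp U in let v := vcomp U in
  let rho := rhocomp U in let l := lambda j U in
  mkstate (- l) 1 (rho * (l * u - v)) (rho * (l * u - v) / sound U ^+ 2).

(* kappa_j is the inverse of (rdir j U) . (grad lambda_j)(U), which normalizes
   r_j . grad lambda_j = 1. *)
Definition rvec (j : nat) (U : state) : state :=
  ('D_(rdir j U) (lambda j : state -> R^o) U)^-1 *: rdir j U.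

(* Centered wave omega (y / x) with Um below and Up above. *)
Definition rarefaction (j : nat) (Um Up : state) : Prop :=
  lambda j Um < lambda j Up /\
  exists omega : R -> state,
    [/\ omega (lambda j Um) = Um, omega (lambda j Up) = Up,
        {within `[lambda j Um, lambda j Up], continuous omega},
        (forall xi, lambda j Um <= xi <= lambda j Up ->
           supersonic (omega xi) /\ lambda j (omega xi) = xi) &
        (forall xi : R, lambda j Um < xi < lambda j Up ->
           is_derive xi 1 omega (rvec j (omega xi)))].

Definition shock (j : nat) (Um Up : state) : Prop :=
  [/\ supersonic Um, supersonic Up &
      exists s : R,
        s *: (Wflux Up - Wflux Um) = Hflux Up - Hflux Um
        /\ lambda j Up < s < lambda j Um].

(* Phi a U, for (a, U) near (0, U0), is a jointly C^2 parametrization of the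
   states that lie above U and are connected to it by a j-wave; the last clause
   says that every such state close to U0 is reached. *)
Definition lax_curve (j : nat) (Phi : R -> state -> state) (U0 : state)
    : Prop :=
  exists2 r : R, 0 < r &
  [/\ C2_on (ball ((0 : R), U0) r) (fun z : R * state => Phi z.1 z.2),
      (forall U, ball U0 r U ->
         Phi 0 U = U /\ is_derive (0 : R) 1 (Phi ^~ U) (rvec j U)),
      (forall U a, ball U0 r U -> 0 < a < r -> rarefaction j U (Phi a U)),
      (forall U a, ball U0 r U -> - r < a < 0 -> shock j U (Phi a U)) &
      (exists2 r' : R, 0 < r' &
         forall U V, ball U0 r' U -> ball U0 r' V ->
           (rarefaction j U V -> exists2 a, 0 < a < r & V = Phi a U) /\
           (shock j U V -> exists2 a, - r < a < 0 & V = Phi a U))].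

End Euler.

Section Waves.
Context {R : realType}.
Notation state := 'rV[R]_4.
Variables Phi1 Phi4 : R -> state -> state.

(* {U, V} = (a1, a2, a3, a4) for states near the same background state;
   eta is the smallness threshold on the strengths. *)
Definition weak_waves (eta : R) (U V : state) (a1 a2 a3 a4 : R) : Prop :=
  [/\ `|a1| < eta, `|a2| < eta, `|a3| < eta, `|a4| < eta &
      V = Phi4 a4 (Phi3 a3 (Phi2 a2 (Phi1 a1 U)))].

(* {U, V} = (d1, s2, s3, d4) for states on the two sides of the strong
   discontinuity of strengths (s20, s30). *)
Definition strong_waves (s20 s30 eta : R) (U V : state) (d1 s2 s3 d4 : R)
    : Prop :=
  [/\ `|d1| < eta, `|s2 - s20| < eta, `|s3 - s30| < eta, `|d4| < eta &
      V = Phi4 d4 (G23 s3 s2 (Phi1 d1 U))].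

End Waves.

(* x = y + O(1) D, with |O(1)| <= M. *)
Definition eq_upto {R : realType} (M D x y : R) : Prop :=
  exists2 o : R, `|o| <= M & x = y + o * D.

(* Main.v *)
From HB Require Import structures.
Require Import Defs.
From mathcomp Require Import all_boot all_order all_algebra.
From mathcomp Require Import all_classical all_reals all_analysis.
From mathcomp Require Import ring lra.

Import Order.TTheory GRing.Theory Num.Theory.
Import numFieldNormedType.Exports.
Local Open Scope ring_scope.

(** Write F(d; U1) = Phi4(d4; G23(d3, d2; Phi1(d1; U1))). The derivative of F in d
    at the background is the matrix whose rows are the wave directions; at v = 0
    the normalizing factors of r_1 and r_4 coincide and are positive, which makes
    this matrix invertible and gives the coefficient with which a 1-wave hitting
    the strong discontinuity is reflected into a 4-wave the form
    (P1 - E P2) / (P1 + E P2) with P1, P2, E > 0, hence modulus < 1.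
    Invertibility and Banach's theorem solve F(d; U1) = U3. Comparing the solution
    d with the linear guess d* = (0, s2 + b2, s3 + b3, a4), the difference
    F(d; U1) - F(d*; U1) is b1 r_1 + o(|b1|) plus the commutator
    G23(b; Phi4(a4; Y)) - Phi4(a4; G23(b; Y)), which vanishes for a4 = 0 and for
    b = 0 and is therefore O(|a4| (|b2| + |b3|)) because Phi4 is C^2.
    Every estimate uses strict derivatives, so it is uniform in the base state. *)

Set Implicit Arguments.
Unset Strict Implicit.
Unset Printing Implicit Defensive.

(* [ssrfun.pcomp] shadows the pressure component. *)
Local Notation pcomp := Defs.pcomp.

(** * Strict derivatives *)

Section StrictDerivative.
Local Open Scope classical_set_scope.
Context {R : realType}.

(** Candidate derivatives are plain functions: over the reals a bounded additive map is
    automatically linear, so no bundled structure has to be carried through compositions. *)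
Definition bounded_additive {V W : normedModType R} (L : V -> W) : Prop :=
  {morph L : x y / x - y} /\ exists2 C : R, 0 < C & forall v, `|L v| <= C * `|v|.

(** Both points vary: f - L is Lipschitz near x0 with an arbitrarily small constant. This is
    stronger than Frechet differentiability at x0 and is what a contraction argument needs. *)
Definition strict_deriv {V W : normedModType R} (f : V -> W) (x0 : V)
    (L : V -> W) : Prop :=
  bounded_additive L /\
  forall e : R, 0 < e -> exists2 d : R, 0 < d &
    forall x y, ball x0 d x -> ball x0 d y ->
      `|f x - f y - L (x - y)| <= e * `|x - y|.

Lemma normr_ball {V : normedModType R} (x y : V) (e : R) :
  ball x e y <-> `|y - x| < e.
Proof. by rewrite -ball_normE /ball_/= distrC. Qed.

Lemma strict_deriv_lipschitz {V W : normedModType R} (f : V -> W) x0 L :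
  strict_deriv f x0 L -> exists C d : R, [/\ 0 < C, 0 < d &
    forall x y, ball x0 d x -> ball x0 d y -> `|f x - f y| <= C * `|x - y|].
Proof.
move=> [[_ [C C0 hC]] /(_ 1 ltr01)[d d0 hd]]; exists (C + 1), d; split => //.
  by rewrite addr_gt0.
move=> x y hx hy; rewrite -(subrK (L (x - y)) (f x - f y)).
rewrite (le_trans (ler_normD _ _))// mulrDl addrC lerD// hd//.
Qed.

Lemma strict_deriv_near {V W : normedModType R} (f : V -> W) x0 L (e : R) :
  strict_deriv f x0 L -> 0 < e ->
  exists2 d : R, 0 < d & forall x, ball x0 d x -> ball (f x0) e (f x).
Proof.
move=> /strict_deriv_lipschitz[C [d [C0 d0 hd]]] e0.
exists (Num.min d (e / C)); first by rewrite lt_min d0 divr_gt0.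
move=> x /normr_ball; rewrite lt_min => /andP[xd xe]; apply/normr_ball.
apply: (le_lt_trans (hd _ _ _ _)); [exact/normr_ball|exact: ballxx|].
by rewrite mulrC -ltr_pdivlMr.
Qed.

Lemma strict_deriv_linear {V W : normedModType R} (L : V -> W) x0 :
  bounded_additive L -> strict_deriv L x0 L.
Proof.
move=> bL; split => // e e0; exists 1 => // x y _ _.
by rewrite bL.1 subrr normr0 mulr_ge0// ltW.
Qed.

Lemma strict_deriv_comp {U V W : normedModType R} (f : U -> V) (g : V -> W)
    x0 L M :
  strict_deriv f x0 L -> strict_deriv g (f x0) M ->
  strict_deriv (g \o f) x0 (M \o L).
Proof.
move=> df dg.
have [[Lm [CL CL0 hL]] hf] := df; have [[Mm [CM CM0 hM]] hg] := dg.
split.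
  split=> [x y|] /=; first by rewrite Lm Mm.
  exists (CM * CL) => [|v /=]; first exact: mulr_gt0.
  by rewrite (le_trans (hM _))// -mulrA ler_pM2l.
move=> e e0.
have [Cf [df1 [Cf0 df10 hf1]]] := strict_deriv_lipschitz df.
(* Each error gets half of e: that of g is measured against [f x - f y], hence [Cf], and that of f
   is amplified by M, hence [CM]. *)
have [d1 d10 h1] := hg (e / (2 * Cf)) ltac:(by rewrite !(divr_gt0, mulr_gt0)).
have [d2 d20 h2] := hf (e / (2 * CM)) ltac:(by rewrite !(divr_gt0, mulr_gt0)).
have [d3 d30 h3] := strict_deriv_near df d10.
exists (Num.min d2 (Num.min df1 d3)); first by rewrite !lt_min d20 df10 d30.
move=> x y hx hy /=.
have bl (d' : R) z : Num.min d2 (Num.min df1 d3) <= d' ->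
    ball x0 (Num.min d2 (Num.min df1 d3)) z -> ball x0 d' z.
  by move=> ?; exact: le_ball.
have -> : g (f x) - g (f y) - M (L (x - y)) =
    (g (f x) - g (f y) - M (f x - f y)) + M (f x - f y - L (x - y)).
  by rewrite [M (_ - L _)]Mm addrA subrK.
rewrite (le_trans (ler_normD _ _))// (splitr e) mulrDl lerD//.
- apply: (le_trans (h1 _ _ _ _)).
  + by apply: h3; apply: bl hx; rewrite !ge_min lexx !orbT.
  + by apply: h3; apply: bl hy; rewrite !ge_min lexx !orbT.
  + apply: (@le_trans _ _ (e / (2 * Cf) * (Cf * `|x - y|))).
      rewrite ler_pM2l ?divr_gt0 ?mulr_gt0// hf1//.
      * by apply: bl hx; rewrite !ge_min lexx !orbT.
      * by apply: bl hy; rewrite !ge_min lexx !orbT.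
    rewrite mulrA ler_wpM2r//.
    by suff -> : e / (2 * Cf) * Cf = e / 2 by []; field; rewrite gt_eqF.
- rewrite (le_trans (hM _))//.
  apply: (@le_trans _ _ (CM * (e / (2 * CM) * `|x - y|))).
    rewrite ler_pM2l// h2//.
    + by apply: bl hx; rewrite !ge_min lexx ?orbT.
    + by apply: bl hy; rewrite !ge_min lexx ?orbT.
  rewrite mulrA ler_wpM2r//.
  by suff -> : CM * (e / (2 * CM)) = e / 2 by []; field; rewrite gt_eqF.
Qed.

Lemma strict_deriv_eq {V W : normedModType R} (f g : V -> W) x0 L M :
  f =1 g -> L =1 M -> strict_deriv f x0 L -> strict_deriv g x0 M.
Proof. by move=> /funext -> /funext ->. Qed.

Lemma prod_normE {V W : normedModType R} (x : V * W) :
  `|x| = Num.max `|x.1| `|x.2|.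
Proof. by []. Qed.

Lemma strict_deriv_pair {U V W : normedModType R} (f : U -> V) (g : U -> W)
    x0 L M :
  strict_deriv f x0 L -> strict_deriv g x0 M ->
  strict_deriv (fun x => (f x, g x)) x0 (fun x => (L x, M x)).
Proof.
move=> [[Lm [CL CL0 hL]] hf] [[Mm [CM CM0 hM]] hg]; split.
  split=> [x y|] /=; first by rewrite Lm Mm.
  exists (Num.max CL CM) => [|v]; first by rewrite lt_max CL0.
  rewrite prod_normE/= ge_max; apply/andP.
  by split; [apply: le_trans (hL v) _|apply: le_trans (hM v) _];
    rewrite ler_wpM2r// le_max lexx ?orbT.
move=> e e0; have [d1 d10 h1] := hf _ e0; have [d2 d20 h2] := hg _ e0.
exists (Num.min d1 d2); first by rewrite lt_min d10.
move=> x y hx hy; rewrite prod_normE/= ge_max.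
by rewrite h1 ?h2//; [apply: le_ball hx|apply: le_ball hy|apply: le_ball hx|
  apply: le_ball hy]; rewrite ge_min lexx ?orbT.
Qed.

Lemma strict_deriv_fst {V W : normedModType R} (x0 : V * W) :
  strict_deriv fst x0 fst.
Proof.
apply: strict_deriv_linear; split=> //; exists 1 => // v.
by rewrite mul1r prod_normE le_max lexx.
Qed.

Lemma strict_deriv_snd {V W : normedModType R} (x0 : V * W) :
  strict_deriv snd x0 snd.
Proof.
apply: strict_deriv_linear; split=> //; exists 1 => // v.
by rewrite mul1r prod_normE le_max lexx orbT.
Qed.

Lemma strict_deriv_mulr (p : R * R) :
  strict_deriv (fun x : R * R => x.1 * x.2) p (fun v => p.1 * v.2 + v.1 * p.2).
Proof.
have le1 (x : R * R) : `|x.1| <= `|x| by rewrite prod_normE le_max lexx.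
have le2 (x : R * R) : `|x.2| <= `|x| by rewrite prod_normE le_max lexx orbT.
split.
  split=> [x y|] /=; first by ring.
  exists (`|p.1| + `|p.2| + 1) => [|v]; first by rewrite ltr_wpDl ?addr_ge0.
  rewrite (le_trans (ler_normD _ _))// !normrM 2!mulrDl mul1r.
  rewrite ler_wpDr// lerD ?ler_wpM2l//.
  by rewrite mulrC ler_wpM2l.
move=> e e0; exists (e / 2); first by rewrite divr_gt0.
move=> x y /normr_ball hx /normr_ball hy.
(* The remainder of a product is exactly bilinear: each term has one factor [x - y] and one factor
   smaller than e / 2. *)
have -> : x.1 * x.2 - y.1 * y.2 - (p.1 * (x - y).2 + (x - y).1 * p.2) =
   (x - p).1 * (x - y).2 + (x - y).1 * (y - p).2 by rewrite /=; ring.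
rewrite (le_trans (ler_normD _ _))// !normrM (splitr e) mulrDl lerD//.
  by rewrite ler_pM// ltW// (le_lt_trans (le1 _)).
by rewrite mulrC ler_pM// ltW// (le_lt_trans (le2 _)).
Qed.

Lemma strict_derivM {V : normedModType R} (f g : V -> R) x0 L M :
  strict_deriv f x0 L -> strict_deriv g x0 M ->
  strict_deriv (fun x => f x * g x) x0 (fun v => f x0 * M v + L v * g x0).
Proof.
move=> sf sg.
exact: (strict_deriv_comp (strict_deriv_pair sf sg) (strict_deriv_mulr _)).
Qed.

Lemma coord_le_norm {n} (x : 'rV[R]_n) i : `|x 0 i| <= `|x|.
Proof.
rewrite [leRHS]/Num.Def.normr/= mx_normrE.
exact: (le_bigmax _ (fun ij : 'I_1 * 'I_n => `|x ij.1 ij.2|) (0, i)).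
Qed.

Lemma norm_le_coord {n} (x : 'rV[R]_n) (e : R) : 0 <= e ->
  (forall i, `|x 0 i| <= e) -> `|x| <= e.
Proof.
move=> e0 h; rewrite /Num.Def.normr/= mx_normrE (bigmax_le _ e0)//= => -[i j] _.
by rewrite ord1.
Qed.

Lemma strict_deriv_coord {n} (x0 : 'rV[R]_n) i :
  strict_deriv (fun x : 'rV[R]_n => x 0 i) x0 (fun v => v 0 i).
Proof.
apply: strict_deriv_linear; split=> [x y|]; first by rewrite !mxE.
by exists 1 => // v; rewrite mul1r coord_le_norm.
Qed.

Lemma strict_deriv_row {V : normedModType R} {n} (f : V -> 'rV[R]_n) x0
    (L : V -> 'rV[R]_n) :
  (forall i, strict_deriv (fun x => f x 0 i) x0 (fun v => L v 0 i)) ->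
  strict_deriv f x0 L.
Proof.
move=> h; split.
  split=> [x y|]; first by apply/rowP => i; rewrite (h i).1.1 !mxE.
  have /choice[C hC] : forall i, exists C : R, 0 < C /\ forall v, `|L v 0 i| <= C * `|v|.
    by move=> i; have [_ [C ? ?]] := (h i).1; exists C.
  have C0 : 0 <= \sum_i C i by rewrite sumr_ge0// => i _; exact/ltW/(hC i).1.
  exists (\sum_i C i + 1) => [|v]; first by rewrite ltr_wpDl.
  apply: norm_le_coord => [|i]; first by rewrite mulr_ge0// addr_ge0.
  rewrite (le_trans ((hC i).2 v))// ler_wpM2r// (bigD1 i)//= -addrA lerDl.
  by rewrite addr_ge0// sumr_ge0// => j _; exact/ltW/(hC j).1.
move=> e e0.
have /choice[d hd] : forall i, exists d : R, 0 < d /\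
    forall x y, ball x0 d x -> ball x0 d y ->
      `|f x 0 i - f y 0 i - L (x - y) 0 i| <= e * `|x - y|.
  by move=> i; have [d ? ?] := (h i).2 e e0; exists d.
(* The default 1 makes the minimum positive even for n = 0. *)
exists (\big[Num.min/1]_i d i).
  by apply: lt_bigmin => // i _; exact: (hd i).1.
move=> x y hx hy; apply: norm_le_coord => [|i]; first by rewrite mulr_ge0// ltW.
by rewrite !mxE (hd i).2//; [apply: le_ball hx|apply: le_ball hy]; exact: bigmin_le.
Qed.

(** * Mean value estimates and maps of class C1 *)

Lemma mean_value_bound (f f' : R -> R) (C : R) :
  (forall t : R, 0 <= t <= 1 -> is_derive t 1 f (f' t)) ->
  (forall t : R, 0 <= t <= 1 -> `|f' t| <= C) -> `|f 1 - f 0| <= C.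
Proof.
move=> df hC.
have [||c /[!in_itv]/= c01 ->] := @MVT_segment R f f' 0 1 ler01.
- by move=> x; rewrite in_itv/= => /andP[/ltW ? /ltW ?]; apply: df; apply/andP.
- apply: derivable_within_continuous => x; rewrite in_itv/= => ?.
  by have [] := df x ltac:(done).
by rewrite subr0 mulr1 hC.
Qed.

Lemma is_derive_coord {n} (f : R -> 'rV[R]_n) (t : R) df i :
  is_derive t 1 f df -> is_derive t 1 (fun s => f s 0 i) (df 0 i).
Proof.
move=> [fd <-]; apply: DeriveDef; first exact: (derivable_mxP _ _ _).1.
by rewrite (derive_mx fd) mxE.
Qed.

Lemma is_derive_line {V W : normedModType R} (f : V -> W) (y w : V) (t : R) :
  differentiable f (y + t *: w) ->
  is_derive t 1 (fun s : R => f (y + s *: w)) ('d f (y + t *: w) w).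
Proof.
move=> df.
have dg : is_diff t (fun s : R => y + s *: w) (fun h => 0 + h *: w).
  exact: is_diffD.
have dfg : is_diff t (f \o (fun s : R => y + s *: w))
    ('d f (y + t *: w) \o (fun h : R => 0 + h *: w)).
  by apply: is_diff_comp; exact: differentiableP.
apply: DeriveDef; first exact/derivable1_diffP/ex_diff.
by rewrite deriveE; [rewrite diff_val/= add0r scale1r|exact: ex_diff].
Qed.

Lemma ball_convex {V : normedModType R} (a x y : V) (d t : R) :
  0 <= t <= 1 -> ball a d x -> ball a d y -> ball a d (y + t *: (x - y)).
Proof.
move=> /andP[t0 t1] /normr_ball hx /normr_ball hy; apply/normr_ball.
have -> : y + t *: (x - y) - a = (1 - t) *: (y - a) + t *: (x - a).
  have -> : x - y = (x - a) - (y - a) by rewrite opprB addrA subrK.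
  by rewrite scalerBl scale1r scalerBr addrAC -[RHS]addrA [- _ + _]addrC.
rewrite (le_lt_trans (ler_normD _ _))// !normrZ.
rewrite (ger0_norm t0) ger0_norm ?subr_ge0//.
(* Strictness comes from the term weighted by 1 - t, which vanishes at t = 1. *)
have [->|t1'] := eqVneq t 1; first by rewrite subrr mul0r add0r mul1r.
have -> : d = (1 - t) * d + t * d by ring.
rewrite ltr_leD//.
  by rewrite ltr_pM2l// subr_gt0 lt_neqAle t1'.
by rewrite ler_wpM2l// ltW.
Qed.

Lemma is_derive_sub_line (f : R -> R) (df c t : R) :
  is_derive t 1 f df -> is_derive t 1 (fun s => f s - s * c) (df - c).
Proof.
move=> h; apply: is_derive_eq.
by rewrite /GRing.scale/= mulr0 add0r mulr1.
Qed.

(** The mean value theorem is applied, along the segment from y to x, to [expR] minus its linear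
    part at a; the derivative of that difference is small by continuity of [expR] at a. *)
Lemma strict_deriv_expR (a : R) : strict_deriv expR a (fun v => expR a * v).
Proof.
split.
  split=> [x y|]; first by rewrite mulrBr.
  by exists (expR a) => [|v]; [exact: expR_gt0|rewrite normrM ger0_norm// expR_ge0].
move=> e e0.
have /cvgrPdist_le/(_ e e0)/nbhs_ballP[d /= d0 hd] := @continuous_expR R a.
exists d => // x y hx hy.
pose g (t : R) := expR (y + t *: (x - y)) - expR a * (x - y) * t.
have -> : expR x - expR y - expR a * (x - y) = g 1 - g 0.
  by rewrite /g scale1r scale0r addr0 mulr0 mulr1 subr0 subrKC; ring.
apply: (@mean_value_bound g
   (fun t => (expR (y + t *: (x - y)) - expR a) * (x - y))).
  move=> t _.
  have de : is_derive (y + t *: (x - y)) 1 expR (expR (y + t *: (x - y))).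
    exact: is_derive_expR.
  have : is_derive t 1 (fun s : R => expR (y + s *: (x - y)) : R)
      ((x - y) *: expR (y + t *: (x - y))).
    have df : differentiable (expR : R -> R) (y + t *: (x - y)).
      exact/derivable1_diffP/ex_derive.
    by have := is_derive_line df; rewrite diff1E//= derive1E derive_val.
  move=> h; apply: is_derive_eq.
  by rewrite /GRing.scale/= mulr1 [RHS]mulrBl [X in X - _]mulrC.
move=> t t01; rewrite normrM ler_wpM2r// distrC hd//.
exact: ball_convex.
Qed.

(** In finite dimension, pointwise continuity of a family of linear maps is continuity in operator
    norm: it suffices to control the images of the n + 1 basis vectors. *)
Lemma linear_family_near {n m} 
    (D : R * 'rV[R]_n -> {linear (R * 'rV[R]_n)%type -> 'rV[R]_m})
    z0 :
  (forall v, {for z0, continuous (fun z => D z v)}) ->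
  forall e : R, 0 < e -> exists2 d : R, 0 < d & forall z, ball z0 d z ->
    forall v, `|D z v - D z0 v| <= e * `|v|.
Proof.
move=> Dc e e0.
have decomp (v : R * 'rV[R]_n) z : D z v =
    v.1 *: D z (1, 0) + \sum_k v.2 0 k *: D z (0, delta_mx 0 k).
  have {1}-> : v = v.1 *: (1, 0) + \sum_k v.2 0 k *: (0, delta_mx 0 k).
    case: v => a w; apply/pair_equal_spec; split=> /=.
      rewrite raddf_sum/= big1 ?addr0 => [|k _]; first by rewrite [_%:A]mulr1.
      by rewrite scaler0.
    by rewrite raddf_sum/= scaler0 add0r [LHS]row_sum_delta.
  rewrite linearD linearZ linear_sum/=; congr (_ + _).
  by apply: eq_bigr => k _; rewrite linearZ.
(* One share of e for each of the n + 1 basis vectors. *)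
pose e' := e / (n%:R + 1).
have e'0 : 0 < e' by rewrite divr_gt0// ltr_wpDl.
have near1 v : \forall z \near z0, `|D z v - D z0 v| < e'.
  have /cvgrPdist_lt/(_ _ e'0) h := Dc v.
  by near do rewrite distrC.
have near2 : \forall z \near z0, forall k,
    `|D z (0, delta_mx 0 k) - D z0 (0, delta_mx 0 k)| < e'.
  apply: (@filter_forall _ 'I_n (fun k z =>
    `|D z (0, delta_mx 0 k) - D z0 (0, delta_mx 0 k)| < e') _ (nbhs_filter z0)) => k.
  exact: near1.
have [d d0 hd] := (nbhs_ballP _ _).1 (filterI (near1 (1, 0)) near2).
exists d => // z /hd[/= h1 h2] v.
rewrite (decomp v z) (decomp v z0) opprD addrACA -scalerBr -sumrB.
rewrite (le_trans (ler_normD _ _))//.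
have -> : e * `|v| = `|v| * e' + \sum_(k < n) `|v| * e'.
  rewrite sumr_const card_ord -mulr_natr /e'; field.
  by rewrite gt_eqF// ltr_wpDl.
rewrite lerD//.
  by rewrite normrZ ler_pM ?(ltW h1)// prod_normE le_max lexx.
rewrite (le_trans (ler_norm_sum _ _ _))// ler_sum// => k _.
rewrite -scalerBr normrZ ler_pM ?(ltW (h2 k))//.
by rewrite (le_trans (coord_le_norm _ _))// prod_normE le_max lexx orbT.
Unshelve. all: by end_near. Qed.

(** Subtracting the differential at z0 leaves a map with small differential near z0. The mean value
    theorem on segments turns this into a small Lipschitz constant, coordinate by coordinate, which
    costs nothing in the sup norm. *)
Lemma strict_deriv_C1 {n m} (f : R * 'rV[R]_n -> 'rV[R]_m) z0 (r : R) :
  0 < r -> C1_on (ball z0 r) f -> strict_deriv f z0 ('d f z0).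
Proof.
move=> r0 fC1.
split.
  split=> [x y|]; first exact: linearB.
  have : bounded_near ('d f z0) (nbhs (0 : R * 'rV[R]_n)).
    apply: continuous_linear_bounded; apply: diff_continuous.
    by have [] := fC1 z0 (ballxx _ r0).
  move=> /linear_boundedP[M [Mr hM]].
  exists (Num.max M 0 + 1) => [|v]; first by rewrite ltr_wpDl// le_max lexx orbT.
  by apply: hM; rewrite ltr_pwDr// le_max lexx.
move=> e e0.
have [d d0 hd] := linear_family_near (D := fun z => 'd f z)
  (fC1 z0 (ballxx _ r0)).2 e0.
exists (Num.min r d); first by rewrite lt_min r0.
move=> x y hx hy.
pose g i (t : R) := f (y + t *: (x - y)) 0 i - t * 'd f z0 (x - y) 0 i.
apply: norm_le_coord => [|i]; first by rewrite mulr_ge0// ltW.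
have -> : (f x - f y - 'd f z0 (x - y)) 0 i = g i 1 - g i 0.
  by rewrite /g scale1r scale0r addr0 mul0r mul1r subr0 subrKC !mxE; ring.
apply: (@mean_value_bound (g i) (fun t =>
  'd f (y + t *: (x - y)) (x - y) 0 i - 'd f z0 (x - y) 0 i)).
  move=> t t01.
  have df : differentiable f (y + t *: (x - y)).
    have := ball_convex t01 hx hy => hb.
    by apply: (fC1 _ _).1; apply: le_ball hb; rewrite ge_min lexx.
  have h := is_derive_coord i (is_derive_line df).
  exact: (is_derive_sub_line ('d f z0 (x - y) 0 i) h).
move=> t t01.
have := ball_convex t01 hx hy => hb.
have hb' : ball z0 d (y + t *: (x - y)).
  by apply: le_ball hb; rewrite ge_min lexx orbT.
apply: le_trans (hd _ hb' (x - y)); apply: le_trans (coord_le_norm _ i); rewrite !mxE//.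
Qed.

(** * Solving equations near a point with invertible derivative *)

Lemma mulmx_bounded {m n} (B : 'M[R]_(m, n)) :
  exists2 C : R, 0 < C & forall w : 'rV[R]_m, `|w *m B| <= C * `|w|.
Proof.
have S0 : 0 <= \sum_k \sum_j `|B k j| by apply: sumr_ge0 => k _; exact: sumr_ge0.
exists (\sum_k \sum_j `|B k j| + 1) => [|w]; first by rewrite ltr_wpDl.
apply: norm_le_coord => [|j]; first by rewrite mulr_ge0// addr_ge0.
rewrite mxE (le_trans (ler_norm_sum _ _ _))// mulrDl ler_wpDr ?mul1r//.
rewrite mulr_suml ler_sum// => k _; rewrite normrM mulrC ler_pM ?coord_le_norm//.
by rewrite (bigD1 j)//= lerDl sumr_ge0.
Qed.

(* The library does not join the normed and complete structures on rows. *)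
Definition rV_complete n : completeNormedModType R := HB.pack 'rV[R]_n.

(** Newton iteration with the derivative frozen at the base point is a contraction depending on U
    and T as parameters; one radius eps serves all of them. *)
Lemma strict_deriv_solve {n} {V : normedModType R}
    (F : 'rV[R]_n * V -> 'rV[R]_n) d0 U0 L (B : 'M[R]_n) :
  strict_deriv F (d0, U0) L -> (forall w, L (w, 0) = w *m B) -> B \in unitmx ->
  forall eta : R, 0 < eta -> exists2 eps : R, 0 < eps &
    forall U T, ball U0 eps U -> ball (F (d0, U0)) eps T ->
      exists2 d, ball d0 eta d & F (d, U) = T.
Proof.
move=> dF LB uB eta eta0.
have [C C0 hC] := mulmx_bounded (invmx B).
(* Since C bounds the inverse of B, this tolerance gives contraction ratio 1 / 2. *)
have [d d0' hd] := dF.2 (2 * C)^-1 ltac:(by rewrite invr_gt0 mulr_gt0).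
pose r := Num.min eta d / 2.
have r0 : 0 < r by rewrite divr_gt0// lt_min eta0.
have reta : r < eta.
  rewrite (@lt_le_trans _ _ (Num.min eta d))// ?ge_min ?lexx//.
  by rewrite ltr_pdivrMr// ltr_pMr ?lt_min ?eta0// ltr1n.
have rd : r < d.
  rewrite (@lt_le_trans _ _ (Num.min eta d))// ?ge_min ?lexx ?orbT//.
  by rewrite ltr_pdivrMr// ltr_pMr ?lt_min ?eta0// ltr1n.
(* Moving U and moving T each change the residual at d0 by at most r / (4 C), so the first iterate
   moves by at most r / 2; the contraction uses up the other half of r. *)
have [d2 d20 hd2] := strict_deriv_near dF (e := r / (4 * C))
  ltac:(by rewrite divr_gt0// mulr_gt0).
exists (Num.min (Num.min d d2) (r / (4 * C))).
  by rewrite !lt_min d0' d20 divr_gt0// mulr_gt0.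
move=> U T; rewrite -!ball_normE /ball_/= !lt_min.
move=> /andP[/andP[Ud Ud2] _] /andP[_ FT].
pose A := [set x : 'rV[R]_n | `|d0 - x| <= r].
pose f (x : 'rV[R]_n) := x - (F (x, U) - T) *m invmx B.
have bA x : A x -> ball (d0, U0) d (x, U).
  move=> Ax; split => /=; rewrite -ball_normE//=.
  exact: le_lt_trans Ax rd.
have fl x y : A x -> A y -> `|f x - f y| <= 2^-1 * `|x - y|.
  move=> Ax Ay.
  have -> : f x - f y = - (F (x, U) - F (y, U) - L ((x, U) - (y, U))) *m invmx B.
    have -> : (x, U) - (y, U) = (x - y, 0) by congr (_, _); rewrite subrr.
    rewrite LB mulNmx mulmxBl mulmxK// opprB /f !mulmxBl.
    have aux (a b p q s : 'rV[R]_n) : a - (p - s) + (q - s - b) = - (p - q - (a - b)).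
      by apply/rowP => i; rewrite !mxE; ring.
    exact: aux.
  rewrite (le_trans (hC _))// normrN.
  have := hd _ _ (bA _ Ax) (bA _ Ay).
  have -> : `|(x, U) - (y, U)| = `|x - y|.
    by rewrite prod_normE/= subrr normr0; apply/max_idPl.
  rewrite -(ler_pM2l C0) => /le_trans; apply.
  rewrite mulrA ler_wpM2r//.
  by suff -> : C * (2 * C)^-1 = 2^-1 by []; field; rewrite gt_eqF.
have f0 : `|f d0 - d0| <= r / 2.
  have -> : f d0 - d0 = - (F (d0, U) - T) *m invmx B by rewrite /f mulNmx addrAC subrr add0r.
  rewrite (le_trans (hC _))// normrN.
  have /normr_ball h1 : ball (F (d0, U0)) (r / (4 * C)) (F (d0, U)).
    by apply: hd2; split; [exact: ballxx|rewrite -ball_normE].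
  have -> : r / 2 = C * (r / (4 * C) + r / (4 * C)) by field; rewrite gt_eqF.
  rewrite ler_pM2l// -(subrKA (F (d0, U0))) (le_trans (ler_normD _ _))//.
  by rewrite lerD// ltW.
have fA : {homo f : x / A x >-> A x}.
  move=> x Ax; rewrite /A/= distrC -(subrKA (f d0)) (le_trans (ler_normD _ _))//.
  rewrite (splitr r) lerD// (le_trans (fl _ _ _ _))//.
    by rewrite /A/= subrr normr0 ltW.
  by rewrite mulrC ler_pM2r// distrC.
have [|||p Ap pf] := @banach_fixed_point R (rV_complete n) A (mkfun fA).
- exists (2^-1)%:nng; split=> /=; first by rewrite invf_lt1// ltr1n.
  by move=> [x y] [Ax Ay]; exact: fl.
- exact: closed_closed_ball_.
- by exists d0; rewrite /A/= subrr normr0 ltW.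
move: p Ap pf => /= p Ap pf.
exists p; first exact: le_lt_trans Ap reta.
have : (F (p, U) - T) *m invmx B = 0.
  have := congr1 (fun x => p - x) pf.
  by rewrite /= subrr /mkfun /f opprB addrC subrK.
move=> /(congr1 (mulmx ^~ B)) /=; rewrite mulmxKV// mul0mx => /eqP.
by rewrite subr_eq0 => /eqP.
Qed.
End StrictDerivative.

(** * Elementary waves *)

Section States.
Local Open Scope classical_set_scope.
Context {R : realType}.
Notation state := 'rV[R]_4.

Lemma ord4_ind (P : 'I_4 -> Prop) :
  P (inord 0) -> P (inord 1) -> P (inord 2) -> P (inord 3) -> forall i, P i.
Proof.
move=> P0 P1 P2 P3 i; rewrite -[i]inord_val.
by case: i => -[|[|[|[|//]]]] i4.
Qed.

Lemma ucomp_mkstate (a b c d : R) : ucomp (mkstate a b c d) = a.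
Proof. by rewrite /ucomp mxE inordK. Qed.

Lemma vcomp_mkstate (a b c d : R) : vcomp (mkstate a b c d) = b.
Proof. by rewrite /vcomp mxE inordK. Qed.

Lemma pcomp_mkstate (a b c d : R) : pcomp (mkstate a b c d) = c.
Proof. by rewrite /pcomp mxE inordK. Qed.

Lemma rhocomp_mkstate (a b c d : R) : rhocomp (mkstate a b c d) = d.
Proof. by rewrite /rhocomp mxE inordK. Qed.

Definition mkstateE :=
  (ucomp_mkstate, vcomp_mkstate, pcomp_mkstate, rhocomp_mkstate).

Lemma ucomp_lin (a : R) (U V : state) : ucomp (a *: U + V) = a * ucomp U + ucomp V.
Proof. by rewrite /ucomp !mxE. Qed.

Lemma vcomp_lin (a : R) (U V : state) : vcomp (a *: U + V) = a * vcomp U + vcomp V.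
Proof. by rewrite /vcomp !mxE. Qed.

Lemma pcomp_lin (a : R) (U V : state) : pcomp (a *: U + V) = a * pcomp U + pcomp V.
Proof. by rewrite /pcomp !mxE. Qed.

Lemma rhocomp_lin (a : R) (U V : state) :
  rhocomp (a *: U + V) = a * rhocomp U + rhocomp V.
Proof. by rewrite /rhocomp !mxE. Qed.

Definition comp_linE := (ucomp_lin, vcomp_lin, pcomp_lin, rhocomp_lin).

Lemma mkstate0 : 0 = mkstate 0 0 0 0 :> state.
Proof.
by apply/rowP; elim/ord4_ind; rewrite !mxE !inordK.
Qed.

Lemma state_eqP (U V : state) : ucomp U = ucomp V -> vcomp U = vcomp V ->
  pcomp U = pcomp V -> rhocomp U = rhocomp V -> U = V.
Proof. by move=> *; apply/rowP; exact: ord4_ind. Qed.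

Lemma norm_le_comp (U : state) (e : R) : 0 <= e ->
  `|ucomp U| <= e -> `|vcomp U| <= e -> `|pcomp U| <= e -> `|rhocomp U| <= e ->
  `|U| <= e.
Proof. by move=> *; apply: norm_le_coord => //; exact: ord4_ind. Qed.

Lemma ballP (U V : state) (e : R) : ball U e V <->
  [/\ `|ucomp V - ucomp U| < e, `|vcomp V - vcomp U| < e,
      `|pcomp V - pcomp U| < e & `|rhocomp V - rhocomp U| < e].
Proof.
split.
  move=> h; split; rewrite distrC; exact: (h.2 0).
move=> [h0 h1 h2 h3]; split; first by exact: le_lt_trans h0.
move=> i j; rewrite ord1 -ball_normE /=; rewrite distrC.
by move: j; exact: ord4_ind.
Qed.

(** Vortex sheets and entropy waves are commuting scalings, so they form a two-parameter group; this
    merges weak contact strengths into those of the strong front. *)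
Lemma G23_add s3 s2 t3 t2 (U : state) :
  G23 t3 t2 (G23 s3 s2 U) = G23 (s3 + t3) (s2 + t2) U.
Proof.
by apply: state_eqP; rewrite /G23 /Phi3 /Phi2 !mkstateE ?expRD ?mulrA.
Qed.

Lemma G23_0 (U : state) : G23 0 0 U = U.
Proof.
by apply: state_eqP; rewrite /G23 /Phi3 /Phi2 !mkstateE ?expR0 ?mulr1.
Qed.

(* Differential of (s3, s2, U) |-> G23 s3 s2 U in the direction (a3, a2, W). *)
Definition dG23 s3 s2 (U : state) a3 a2 (W : state) : state :=
  mkstate (ucomp U * (expR s2 * a2) + ucomp W * expR s2)
    (vcomp U * (expR s2 * a2) + vcomp W * expR s2)
    (pcomp W) (rhocomp U * (expR s3 * a3) + rhocomp W * expR s3).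

Lemma strict_deriv_mkstate {V : normedModType R} (a b c d : V -> R) x0
    La Lb Lc Ld :
  strict_deriv a x0 La -> strict_deriv b x0 Lb -> strict_deriv c x0 Lc ->
  strict_deriv d x0 Ld ->
  strict_deriv (fun x => mkstate (a x) (b x) (c x) (d x)) x0
    (fun v => mkstate (La v) (Lb v) (Lc v) (Ld v)).
Proof.
move=> da db dc dd; apply: strict_deriv_row. elim/ord4_ind.
- by apply: strict_deriv_eq da => x; rewrite -[RHS]/(ucomp _) ucomp_mkstate.
- by apply: strict_deriv_eq db => x; rewrite -[RHS]/(vcomp _) vcomp_mkstate.
- by apply: strict_deriv_eq dc => x; rewrite -[RHS]/(pcomp _) pcomp_mkstate.
- by apply: strict_deriv_eq dd => x; rewrite -[RHS]/(rhocomp _) rhocomp_mkstate.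
Qed.

Lemma strict_deriv_G23 {V : normedModType R} (s3 s2 : V -> R) (f : V -> state)
    x0 L3 L2 Lf :
  strict_deriv s3 x0 L3 -> strict_deriv s2 x0 L2 -> strict_deriv f x0 Lf ->
  strict_deriv (fun x => G23 (s3 x) (s2 x) (f x)) x0
    (fun v => dG23 (s3 x0) (s2 x0) (f x0) (L3 v) (L2 v) (Lf v)).
Proof.
move=> d3 d2 df.
have comp i := strict_deriv_comp df (strict_deriv_coord (f x0) i).
have e3 := strict_deriv_comp d3 (strict_deriv_expR (s3 x0)).
have e2 := strict_deriv_comp d2 (strict_deriv_expR (s2 x0)).
have := strict_deriv_mkstate (strict_derivM (comp (inord 0)) e2)
  (strict_derivM (comp (inord 1)) e2) (comp (inord 2))
  (strict_derivM (comp (inord 3)) e3).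
by apply: strict_deriv_eq => x //; rewrite /G23 /Phi3 /Phi2 !mkstateE.
Qed.

(** * Differentials of the composed wave maps *)

Variable gamma : R.

(** Both partial derivatives are known: the normalized eigenvector in the strength, and the identity
    in the state, because strength 0 gives the identity on a whole neighbourhood. *)
Lemma lax_curve_strict j (Phi : R -> state -> state) U0 :
  lax_curve gamma j Phi U0 ->
  strict_deriv (fun z : R * state => Phi z.1 z.2) (0, U0)
    (fun v => v.1 *: rvec gamma j U0 + v.2).
Proof.
case=> r r0 [[C1 _] P0 _ _ _].
have := strict_deriv_C1 r0 C1; set f := fun z : R * state => _.
apply: strict_deriv_eq => // -[t w] /=.
have df : differentiable f (0, U0) by have [] := C1 _ (ballxx _ r0).
have -> : (t, w) = t *: (1, 0) + (0, w) :> R * state.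
  by apply/pair_equal_spec; split=> /=; rewrite ?scaler0 ?add0r// addr0 [_%:A]mulr1.
rewrite linearD linearZ/=; congr (_ *: _ + _).
  rewrite -deriveE//; have [_ [_ <-]] := P0 _ (ballxx _ r0).
  rewrite /derive; set g1 := fun h => h^-1 *: _; set g2 := fun h => h^-1 *: _.
  suff -> : g1 = g2 by [].
  by apply/funext => h; rewrite /g1 /g2 /f/= scaler0 add0r.
(* For small h the shifted state stays where strength 0 acts as the identity, so the difference
   quotient is constantly w. *)
rewrite -deriveE// /derive; apply: lim_near_cst => //.
near=> h.
have bU : ball U0 r (h *: w + U0).
  apply/normr_ball; rewrite addrK normrZ.
  rewrite (@le_lt_trans _ _ (`|h| * (`|w| + 1)))//.
    by rewrite ler_wpM2l// lerDl.
  rewrite -ltr_pdivlMr ?ltr_wpDl//.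
  by near: h; apply: dnbhs0_lt; rewrite divr_gt0// ltr_wpDl.
rewrite /f/= scaler0 addr0 (P0 _ bU).1 (P0 _ (ballxx _ r0)).1.
rewrite addrK scalerA mulVf ?scale1r//.
by near: h; exact: nbhs_dnbhs_neq.
Unshelve. all: by end_near. Qed.

(* A strength vector (d1, s2, s3, d4) is packed as the state
   mkstate d1 s2 s3 d4, so ucomp, vcomp, pcomp and rhocomp extract d1, s2, s3
   and d4. *)
Lemma strict_front j Phi (U0 d0 : state) :
  lax_curve gamma j Phi U0 -> ucomp d0 = 0 ->
  strict_deriv (fun z : state * state =>
      G23 (pcomp z.1) (vcomp z.1) (Phi (ucomp z.1) z.2)) (d0, U0)
    (fun v => dG23 (pcomp d0) (vcomp d0) U0 (pcomp v.1) (vcomp v.1)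
       (ucomp v.1 *: rvec gamma j U0 + v.2)).
Proof.
move=> lc d00.
have co i := strict_deriv_comp (strict_deriv_fst (d0, U0)) (strict_deriv_coord d0 i).
have P0 : Phi 0 U0 = U0.
  by case: lc => r r0 [_ + _ _ _] => /(_ _ (ballxx _ r0))[].
have dP : strict_deriv (fun z : state * state => Phi (ucomp z.1) z.2) (d0, U0)
    (fun v => ucomp v.1 *: rvec gamma j U0 + v.2).
  have lcs : strict_deriv (fun z : R * state => Phi z.1 z.2)
      (d0 0 (inord 0), U0) (fun v => v.1 *: rvec gamma j U0 + v.2).
    by rewrite -/(ucomp d0) d00; exact: lax_curve_strict.
  exact: (strict_deriv_comp
    (strict_deriv_pair (co (inord 0)) (strict_deriv_snd (d0, U0))) lcs).
have := strict_deriv_G23 (co (inord 2)) (co (inord 1)) dP.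
by rewrite /= d00 P0.
Qed.

(** The acoustic strengths vanish at [d0], so Psi is differentiated at strength 0, at the state U0
    carried across the contact front. *)
Lemma strict_full j k Phi Psi (U0 d0 : state) :
  lax_curve gamma j Phi U0 -> ucomp d0 = 0 -> rhocomp d0 = 0 ->
  lax_curve gamma k Psi (G23 (pcomp d0) (vcomp d0) U0) ->
  strict_deriv (fun z : state * state => Psi (rhocomp z.1)
      (G23 (pcomp z.1) (vcomp z.1) (Phi (ucomp z.1) z.2))) (d0, U0)
    (fun v => rhocomp v.1 *: rvec gamma k (G23 (pcomp d0) (vcomp d0) U0) +
       dG23 (pcomp d0) (vcomp d0) U0 (pcomp v.1) (vcomp v.1)
       (ucomp v.1 *: rvec gamma j U0 + v.2)).
Proof.
move=> lc d00 d03 lc2.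
have P0 : Phi 0 U0 = U0.
  by case: lc => r r0 [_ + _ _ _] => /(_ _ (ballxx _ r0))[].
have dr := strict_deriv_comp (strict_deriv_fst (d0, U0)) (strict_deriv_coord d0 (inord 3)).
have lcs : strict_deriv (fun z : R * state => Psi z.1 z.2)
    (d0 0 (inord 3), G23 (pcomp d0) (vcomp d0) (Phi (ucomp d0) U0))
    (fun v => v.1 *: rvec gamma k (G23 (pcomp d0) (vcomp d0) U0) + v.2).
  by rewrite -/(rhocomp d0) d03 d00 P0; exact: lax_curve_strict.
exact: (strict_deriv_comp (strict_deriv_pair dr (strict_front lc d00)) lcs).
Qed.

End States.

(** * Wave directions at the background states *)

Section Background.
Local Open Scope classical_set_scope.
Context {R : realType}.
Notation state := 'rV[R]_4.

Lemma is_derive_mul (f g : R -> R) (x df dg : R) :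
  is_derive x 1 f df -> is_derive x 1 g dg ->
  is_derive x 1 (fun t => f t * g t) (df * g x + f x * dg).
Proof.
by move=> hf hg; apply: is_derive_eq; rewrite addrC /GRing.scale/= [df * _]mulrC.
Qed.

Lemma is_derive_div (f g : R -> R) (x df dg : R) : g x != 0 ->
  is_derive x 1 f df -> is_derive x 1 g dg ->
  is_derive x 1 (fun t => f t / g t) ((df * g x - f x * dg) / g x ^+ 2).
Proof.
move=> g0 hf [hg <-].
have hV : is_derive x 1 (fun t => (g t)^-1) (- (g x) ^- 2 * 'D_1 g x).
  by apply: DeriveDef; [exact: derivableV|rewrite deriveV].
by have := is_derive_mul hf hV => /is_derive_eq; apply; field.
Qed.

Lemma is_derive_sqrt_comp (f : R -> R) (x df : R) : 0 < f x ->
  is_derive x 1 f df ->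
  is_derive x 1 (fun t => Num.sqrt (f t)) (df / (2 * Num.sqrt (f x))).
Proof.
move=> f0 hf; have hs := is_derive1_sqrt f0.
by have := @is_derive1_comp _ Num.sqrt f x _ _ hs hf; rewrite mulrC.
Qed.

Lemma is_derive_affine (a b x : R) : is_derive x 1 (fun t => t * a + b) a.
Proof. by apply: is_derive_eq; rewrite /GRing.scale/= mulr0 add0r mulr1 addr0. Qed.

(** Reduces a directional derivative to one real variable, where the product, quotient and square
    root rules apply. *)
Lemma derive_along_line {V W : normedModType R} (f : V -> W) (x v : V) (df : W) :
  is_derive (0 : R) 1 (fun h : R => f (h *: v + x)) df -> 'D_v f x = df.
Proof.
move=> [_ <-]; rewrite /derive; set g1 := fun h => h^-1 *: _.
set g2 := fun h => h^-1 *: _; suff -> : g1 = g2 by [].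
by apply/funext => h; rewrite /g1 /g2/= addr0 scale0r add0r [_%:A]mulr1.
Qed.

Variable gamma : R.

(** Genuine nonlinearity at v = 0. The sign (-1)^j enters only through its square, so both acoustic
    families give the same value, hence the same kappa_j. *)
Lemma derive_lambda_background (u p rho : R) j :
  1 < gamma -> supersonic gamma (mkstate u 0 p rho) ->
  let c := sound gamma (mkstate u 0 p rho) in
  'D_(rdir gamma j (mkstate u 0 p rho)) (lambda gamma j : state -> R^o)
    (mkstate u 0 p rho) =
  (gamma + 1) * u ^+ 3 / (2 * (u ^+ 2 - c ^+ 2) ^+ 2).
Proof.
move=> g1 []; rewrite !mkstateE => p0 rho0 cu c.
have g0 : 0 < gamma by rewrite (lt_trans ltr01).
have c0 : 0 < c by rewrite sqrtr_gt0 !mkstateE divr_gt0// mulr_gt0.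
have c2 : c ^+ 2 = gamma * p / rho.
  by rewrite sqr_sqrtr !mkstateE// ltW// divr_gt0// mulr_gt0.
have u0 : 0 < u by rewrite (lt_trans c0).
have D0 : 0 < u ^+ 2 - c ^+ 2 by rewrite subr_gt0 ltrXn2r// ?ltW.
pose s : R := Num.sqrt (u ^+ 2 - c ^+ 2).
have s0 : 0 < s by rewrite sqrtr_gt0.
have s2 : s ^+ 2 = u ^+ 2 - c ^+ 2 by rewrite sqr_sqrtr// ltW.
pose e : R := (-1) ^+ j.
have e2 : e ^+ 2 = 1 by rewrite sqrr_sign.
(* At v = 0 the square root in lambda_j is s and the denominator is its square. *)
have lE : lambda gamma j (mkstate u 0 p rho) = e * c / s.
  rewrite /lambda !mkstateE -/c -/e mulr0 add0r expr0n addr0 -/s -s2.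
  by field; rewrite gt_eqF.
rewrite /rdir lE !mkstateE -/c subr0.
set v := mkstate (- _) _ _ _.
apply: derive_along_line.
have comp h : [/\ ucomp (h *: v + mkstate u 0 p rho) = h * (- (e * c / s)) + u,
   vcomp (h *: v + mkstate u 0 p rho) = h * 1 + 0,
   pcomp (h *: v + mkstate u 0 p rho) = h * (rho * (e * c / s * u)) + p &
   rhocomp (h *: v + mkstate u 0 p rho) = h * (rho * (e * c / s * u) / c ^+ 2) + rho].
  by rewrite !comp_linE /v !mkstateE.
pose a (h : R) := h * (- (e * c / s)) + u.
pose b (h : R) := h * 1 + 0.
pose P (h : R) := h * (rho * (e * c / s * u)) + p.
pose r (h : R) := h * (rho * (e * c / s * u) / c ^+ 2) + rho.
pose C (h : R) : R := Num.sqrt (gamma * P h / r h).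
pose D (h : R) := a h * a h - C h * C h.
pose S (h : R) : R := Num.sqrt (D h + b h * b h).
pose N (h : R) := a h * b h + e * C h * S h.
have -> : (fun h : R => lambda gamma j (h *: v + mkstate u 0 p rho) : R^o) =
          (fun h => N h / D h).
  apply/funext => h; rewrite /lambda /sound; have [-> -> -> ->] := comp h.
  rewrite -/(a h) -/(b h) -/(P h) -/(r h) -/(C h) -/e !expr2.
  by rewrite /N /D /S /D addrAC.
have a0E : a 0 = u by rewrite /a mul0r add0r.
have b0E : b 0 = 0 by rewrite /b mul0r add0r.
have P0E : P 0 = p by rewrite /P mul0r add0r.
have r0E : r 0 = rho by rewrite /r mul0r add0r.
have C0E : C 0 = c by rewrite /C P0E r0E /c /sound !mkstateE.
have D0E : D 0 = s ^+ 2 by rewrite /D a0E C0E s2 !expr2.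
have S0E : S 0 = s by rewrite /S D0E b0E mul0r addr0 sqrtr_sqr ger0_norm// ltW.
have da := is_derive_affine (- (e * c / s)) u 0 : is_derive (0 : R) (1 : R) a _.
have db := is_derive_affine 1 0 0 : is_derive (0 : R) (1 : R) b _.
have dP := is_derive_affine (rho * (e * c / s * u)) p 0 :
  is_derive (0 : R) (1 : R) P _.
have dr := is_derive_affine (rho * (e * c / s * u) / c ^+ 2) rho 0 :
  is_derive (0 : R) (1 : R) r _.
have dgP : is_derive (0 : R) (1 : R) (fun h => gamma * P h)
    (gamma * (rho * (e * c / s * u))).
  have := is_derive_mul (is_derive_cst gamma (0 : R) (1 : R)) dP.
  by move=> /is_derive_eq; apply; rewrite mul0r add0r.
have r0n : r 0 != 0 by rewrite r0E gt_eqF.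
have q0 : 0 < gamma * P 0 / r 0 by rewrite P0E r0E divr_gt0// mulr_gt0.
have dC0 := is_derive_sqrt_comp (f := fun h => gamma * P h / r h) q0
  (is_derive_div r0n dgP dr).
(* Eliminating p through c^2 = gamma p / rho removes p and rho from the derivative of the sound
   speed. *)
have dC : is_derive (0 : R) (1 : R) C ((gamma - 1) * e * u / (2 * s)).
  move: dC0; rewrite -/(C 0) C0E P0E r0E => /is_derive_eq; apply.
  have -> : p = c ^+ 2 * rho / gamma by rewrite c2; field; rewrite !gt_eqF.
  by field; rewrite !gt_eqF.
have dD : is_derive (0 : R) (1 : R) D (- (e * c * u * (gamma + 1) / s)).
  have := is_deriveB (is_derive_mul da da) (is_derive_mul dC dC).
  by rewrite a0E C0E => /is_derive_eq; apply; field; rewrite gt_eqF.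
have dS : is_derive (0 : R) (1 : R) S (- (e * c * u * (gamma + 1) / (2 * s ^+ 2))).
  have S20 : 0 < D 0 + b 0 * b 0 by rewrite D0E b0E mul0r addr0 exprn_gt0.
  have := is_derive_sqrt_comp (f := fun h => D h + b h * b h) S20
    (is_deriveD dD (is_derive_mul db db)).
  rewrite -/(S 0) S0E b0E => /is_derive_eq; apply; field.
  by rewrite gt_eqF.
have dN : is_derive (0 : R) (1 : R) N (u * (gamma + 1) / 2 * (1 - c ^+ 2 / s ^+ 2)).
  have deC := is_derive_mul (is_derive_cst e (0 : R) (1 : R)) dC.
  have := is_deriveD (is_derive_mul da db) (is_derive_mul deC dS).
  rewrite a0E b0E C0E S0E => /is_derive_eq; apply.
  (* The square of the sign is isolated so that it can be replaced by 1. *)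
  transitivity (u + e ^+ 2 *
    ((gamma - 1) * u / 2 - c ^+ 2 * u * (gamma + 1) / (2 * s ^+ 2))).
    by rewrite /cst; field; rewrite gt_eqF.
  by rewrite e2; field; rewrite gt_eqF.
have D0n : D 0 != 0 by rewrite D0E expf_neq0// gt_eqF.
have := is_derive_div D0n dN dD; rewrite D0E /N a0E b0E C0E S0E -s2.
move=> /is_derive_eq; apply.
have u2 : u ^+ 2 = s ^+ 2 + c ^+ 2 by rewrite s2 subrK.
transitivity ((u * (gamma + 1) / 2 * (s ^+ 2 - c ^+ 2) +
  e ^+ 2 * (c ^+ 2 * u * (gamma + 1))) / (s ^+ 2) ^+ 2).
  by field; rewrite gt_eqF.
by rewrite e2 [u ^+ 3]exprS u2; field; rewrite gt_eqF.
Qed.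

(** Here k is kappa_1 = kappa_4 and P is rho u |lambda_j|; the sign of lambda_j appears only in the
    pressure component. *)
Lemma rvec_background (u p rho : R) :
  1 < gamma -> supersonic gamma (mkstate u 0 p rho) ->
  exists k P : R, [/\ 0 < k, 0 < P & forall j,
    vcomp (rvec gamma j (mkstate u 0 p rho)) = k /\
    pcomp (rvec gamma j (mkstate u 0 p rho)) = (-1) ^+ j * (k * P)].
Proof.
move=> g1 ss; have [] := ss; rewrite !mkstateE => p0 rho0 cu.
pose c := sound gamma (mkstate u 0 p rho).
have g0 : 0 < gamma by rewrite (lt_trans ltr01).
have c0 : 0 < c by rewrite sqrtr_gt0 !mkstateE divr_gt0// mulr_gt0.
have u0 : 0 < u by rewrite (lt_trans c0).
have D0 : 0 < u ^+ 2 - c ^+ 2 by rewrite subr_gt0 ltrXn2r// ?ltW.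
exists ((gamma + 1) * u ^+ 3 / (2 * (u ^+ 2 - c ^+ 2) ^+ 2))^-1.
exists (rho * (c * Num.sqrt (u ^+ 2 - c ^+ 2) / (u ^+ 2 - c ^+ 2) * u)).
split.
- by rewrite invr_gt0 !(divr_gt0, mulr_gt0, exprn_gt0)// ltr_wpDr // ltW.
- by rewrite !(divr_gt0, mulr_gt0)// sqrtr_gt0.
move=> j; rewrite /rvec derive_lambda_background// -/c.
set K := _^-1; split.
  by rewrite -[_ *: _]addr0 mkstate0 comp_linE !mkstateE mulr1 addr0.
rewrite -[_ *: _]addr0 mkstate0 comp_linE !mkstateE addr0 /lambda !mkstateE -/c.
by rewrite mulr0 add0r expr0n addr0; ring.
Qed.
End Background.

(** * Interaction estimates *)

Section Interaction.
Local Open Scope classical_set_scope.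
Context {R : realType}.
Notation state := 'rV[R]_4.

(* The coefficient K may depend on all the data, so a bound on x - y suffices. *)
Lemma split_linear_bound (x y b A C D : R) : 0 <= A -> 0 <= C -> 0 <= D ->
  `|x - y| <= A * `|b| + C * D ->
  exists2 K : R, `|K| <= A & eq_upto C D x (y + K * b).
Proof.
move=> A0 C0 D0 hx; set S := A * `|b| + C * D in hx.
have S0 : 0 <= S by rewrite addr_ge0 ?mulr_ge0.
(* If S = 0 then T = 0, as division by 0 gives 0, and the bound forces x = y. *)
pose T := (x - y) / S.
have T1 : `|T| <= 1.
  rewrite normrM normfV (ger0_norm S0).
  have [->|Sn] := eqVneq S 0; first by rewrite invr0 mulr0.
  by rewrite ler_pdivrMr ?lt_def ?Sn// mul1r.
have xE : x = y + T * S.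
  rewrite /T; have [SE|Sn] := eqVneq S 0; last by rewrite mulfVK// subrKC.
  by move: hx; rewrite SE normr_le0 subr_eq0 mulr0 addr0 => /eqP.
(* The sign makes K b equal to T A |b|; the rest T C D of x - y is the O(1) term. *)
exists (T * A * Num.sg b).
  rewrite 2!normrM (ger0_norm A0) normr_sg.
  case: (b != 0); rewrite /= ?mulr1 ?mulr0//.
  by rewrite ler_piMl.
exists (T * C); first by rewrite normrM (ger0_norm C0) ler_piMl.
by rewrite xE /S normrEsg; ring.
Qed.

(* The v- and p-components of r1' = w B only involve the strengths of the
   acoustic waves; the 4-component of w, the reflection coefficient, is
   (P1 - e^s2 P2) / (P1 + e^s2 P2). *)
Lemma reflection_matrix (s3 s2 k1 P1 k2 P2 : R) (U r1 r1' r4 : state) :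
  0 < ucomp U -> vcomp U = 0 -> 0 < rhocomp U ->
  0 < k1 -> 0 < P1 -> 0 < k2 -> 0 < P2 ->
  vcomp r1 = k1 -> pcomp r1 = - (k1 * P1) ->
  vcomp r1' = k2 -> pcomp r1' = - (k2 * P2) ->
  vcomp r4 = k2 -> pcomp r4 = k2 * P2 ->
  exists B : 'M[R]_4, [/\ B \in unitmx,
    forall w : state, rhocomp w *: r4 +
      dG23 s3 s2 U (pcomp w) (vcomp w) (ucomp w *: r1 + 0) = w *m B &
    `|rhocomp (r1' *m invmx B)| < 1].
Proof.
move=> u0 v0 rho0 k10 P10 k20 P20 r1v r1p r1v' r1p' r4v r4p.
pose L (w : state) := rhocomp w *: r4 +
  dG23 s3 s2 U (pcomp w) (vcomp w) (ucomp w *: r1 + 0).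
have E20 := expR_gt0 s2; have E30 := expR_gt0 s3.
have Lcomp w : [/\
    ucomp (L w) = rhocomp w * ucomp r4 + (ucomp U * (expR s2 * vcomp w) +
      ucomp w * ucomp r1 * expR s2),
    vcomp (L w) = rhocomp w * k2 + ucomp w * k1 * expR s2,
    pcomp (L w) = rhocomp w * (k2 * P2) - ucomp w * (k1 * P1) &
    rhocomp (L w) = rhocomp w * rhocomp r4 + (rhocomp U * (expR s3 * pcomp w) +
      ucomp w * rhocomp r1 * expR s3)].
  rewrite /L !comp_linE /dG23 !mkstateE mkstate0 !comp_linE !mkstateE !addr0.
  by rewrite v0 r1v r1p r4v r4p mul0r add0r mulrN.
have Llin : linear L.
  move=> a x y; have [xu xv xp xr] := Lcomp x; have [yu yv yp yr] := Lcomp y.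
  have [zu zv zp zr] := Lcomp (a *: x + y).
  apply: state_eqP; rewrite [RHS]comp_linE.
  - by rewrite zu xu yu !comp_linE; ring.
  - by rewrite zv xv yv !comp_linE; ring.
  - by rewrite zp xp yp !comp_linE; ring.
  - by rewrite zr xr yr !comp_linE; ring.
pose LL : {linear state -> state} := HB.pack L (GRing.isLinear.Build _ _ _ _ _ Llin).
have LB w : w *m lin1_mx LL = L w by rewrite mul_rV_lin1.
have uB : lin1_mx LL \in unitmx.
  (* Trivial kernel: the v- and p-components force the acoustic strengths to vanish, then the other
     two components do so for the contact strengths, as u and rho are positive. *)
  rewrite -row_free_unit -kermx_eq0; apply/rowV0P => w /sub_kermxP.
  rewrite LB => Lw0; have [] := Lcomp w; rewrite Lw0 mkstate0 !mkstateE.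
  move=> e0 e1 e2 e3.
  have w3 : rhocomp w = 0.
    (* The multipliers P1 and [expR s2] cancel the 1-strength. *)
    have : rhocomp w * (k2 * (P1 + expR s2 * P2)) =
        P1 * (rhocomp w * k2 + ucomp w * k1 * expR s2) +
        expR s2 * (rhocomp w * (k2 * P2) - ucomp w * (k1 * P1)) by ring.
    rewrite -e1 -e2 !mulr0 addr0 => /eqP; rewrite mulf_eq0 => /orP[/eqP//|].
    by rewrite gt_eqF// mulr_gt0// addr_gt0// mulr_gt0.
  have w0 : ucomp w = 0.
    move/esym/eqP: e1; rewrite w3 mul0r add0r !mulf_eq0.
    by rewrite (gt_eqF k10) (gt_eqF E20) !orbF => /eqP.
  apply: state_eqP; rewrite mkstateE//.
  - move/esym/eqP: e0; rewrite w3 w0 !mul0r add0r addr0 !mulf_eq0.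
    by rewrite (gt_eqF u0) (gt_eqF E20) => /eqP.
  - move/esym/eqP: e3; rewrite w3 w0 !mul0r add0r addr0 !mulf_eq0.
    by rewrite (gt_eqF rho0) (gt_eqF E30) => /eqP.
exists (lin1_mx LL); split=> //.
set w := r1' *m _.
have : L w = r1' by rewrite -LB mulmxKV.
have [_ ev ep _] := Lcomp w; move=> Lw; rewrite Lw in ev ep.
have S0 : 0 < P1 + expR s2 * P2 by rewrite addr_gt0// mulr_gt0.
have wE : rhocomp w = (P1 - expR s2 * P2) / (P1 + expR s2 * P2).
  (* The same elimination, now with the 1-wave [r1'] as right-hand side. *)
  apply: (mulIf (lt0r_neq0 (mulr_gt0 k20 S0))).
  have -> : rhocomp w * (k2 * (P1 + expR s2 * P2)) =
      P1 * vcomp r1' + expR s2 * pcomp r1' by rewrite ev ep; ring.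
  by rewrite r1v' r1p'; field; rewrite gt_eqF.
rewrite wE normrM normfV (gtr0_norm S0) ltr_pdivrMr// mul1r ltr_norml.
have := mulr_gt0 E20 P20; move: P10; set t := expR s2 * P2 => ? ?.
by apply/andP; split; lra.
Qed.

Lemma G23_lipschitz (U0 : state) : exists C d : R, [/\ 0 < C, 0 < d &
  forall b2 b3 Y, `|b2| < d -> `|b3| < d -> ball U0 d Y ->
  [/\ `|expR b2 - 1| <= C * (`|b2| + `|b3|),
      `|expR b3 - 1| <= C * (`|b2| + `|b3|) &
      `|G23 b3 b2 Y - Y| <= C * (`|b2| + `|b3|)]].
Proof.
have s1 := strict_deriv_G23
  (strict_deriv_comp (strict_deriv_fst ((0, 0), U0)) (strict_deriv_fst (0, 0)))
  (strict_deriv_comp (strict_deriv_fst ((0, 0), U0)) (strict_deriv_snd (0, 0)))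
  (strict_deriv_snd (((0 : R), (0 : R)), U0)).
have [C1 [d1 [C10 d10 h1]]] := strict_deriv_lipschitz s1.
have [C2 [d2 [C20 d20 h2]]] := strict_deriv_lipschitz (strict_deriv_expR (0 : R)).
exists (C1 + C2), (Num.min d1 d2); split; rewrite ?addr_gt0 ?lt_min ?d10//.
move=> b2 b3 Y; rewrite !lt_min => /andP[b21 b22] /andP[b31 b32] hY.
have e0 (b : R) : `|b| < d2 -> `|expR b - 1| <= C2 * `|b|.
  move=> hb; have := h2 b 0 _ (ballxx _ d20); rewrite expR0 subr0.
  by apply; apply/normr_ball; rewrite subr0.
split.
- apply: le_trans (e0 _ b22) _.
  by apply: ler_pM; rewrite ?lerDr ?lerDl// ltW.
- apply: le_trans (e0 _ b32) _.
  by apply: ler_pM; rewrite ?lerDr ?lerDl// ltW.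
have bY : ball U0 d1 Y by apply: le_ball hY; rewrite ge_min lexx.
have := h1 ((b3, b2), Y) ((0, 0), Y).
rewrite /= G23_0 => h; apply: le_trans (h _ _) _.
- by split=> //; split; rewrite /= -ball_normE /= sub0r normrN.
- by split=> //; split; exact: ballxx.
have -> : ((b3, b2), Y) - ((0, 0), Y) = ((b3, b2), 0).
  by congr ((_, _), _); rewrite ?subr0 ?subrr.
rewrite !prod_normE/= normr0; apply: ler_pM; rewrite ?lerDl//; try exact: ltW.
by rewrite !ge_max lerDr lerDl addr_ge0 !normr_ge0.
Qed.

(** For fixed strengths G23 is a diagonal linear map, so it passes through differentiation in the
    strength of another wave, coordinate by coordinate. *)
Lemma G23_coord b3 b2 (X : state) i :
  G23 b3 b2 X 0 i = mkstate (expR b2) (expR b2) 1 (expR b3) 0 i * X 0 i.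
Proof.
move: i; elim/ord4_ind; rewrite /G23 /Phi3 /Phi2 !mxE !inordK//=;
  rewrite ?mkstateE mulrC ?mulr1//.
Qed.

(** With a replaced by t a, the difference is 0 at t = 0 and its t-derivative is a times (k - 1) g
    plus the variation of g between Y and [G23 b3 b2 Y]. Both are O(|b2| + |b3|), the second because
    g, the derivative in the strength, is C1. *)
Lemma lax_curve_commutator gamma j Phi (U0 : state) :
  lax_curve gamma j Phi U0 ->
  exists C d : R, [/\ 0 < C, 0 < d &
    forall a b2 b3 Y, `|a| < d -> `|b2| < d -> `|b3| < d -> ball U0 d Y ->
    `|G23 b3 b2 (Phi a Y) - Phi a (G23 b3 b2 Y)| <= C * (`|a| * (`|b2| + `|b3|))].
Proof.
move=> [r r0 [[C1 C2] P0 _ _ _]].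
pose f (z : R * state) := Phi z.1 z.2.
have [g gE] : exists g : R * state -> state, g = fun z => 'd f z (1, 0) by eexists.
have sg : strict_deriv g (0, U0) ('d g (0, U0)).
  by rewrite gE; exact: strict_deriv_C1 r0 (C2 (1, 0)).
have [Cg [dg [Cg0 dg0 hg]]] := strict_deriv_lipschitz sg.
have [Cb [db [Cb0 db0 hb]]] := G23_lipschitz U0.
pose m := Num.min (Num.min r dg) db.
have m0 : 0 < m by rewrite !lt_min r0 dg0 db0.
(* M bounds |g| on the ball of radius m; the second entry of d keeps [G23 b3 b2 Y] in that ball. *)
pose M := `|g (0, U0)| + Cg * m.
pose d := Num.min (m / 2) (m / (4 * Cb)).
have d0 : 0 < d by rewrite lt_min !(divr_gt0, mulr_gt0).
have dm : d <= m / 2 by rewrite ge_min lexx.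
have dm' : d < m by rewrite (le_lt_trans dm)// ltr_pdivrMr// ltr_pMr// ltr1n.
have [mr mg mb] : [/\ m <= r, m <= dg & m <= db].
  by rewrite !ge_min !lexx ?orbT.
have C0 : 0 < Cb * M + Cg * Cb.
  by rewrite addr_gt0 ?mulr_gt0// ltr_wpDl// mulr_gt0.
exists (Cb * M + Cg * Cb), d; split => //.
move=> a b2 b3 Y ha hb2 hb3 hY.
have [e2 e3 hG] := hb b2 b3 Y (lt_le_trans hb2 (le_trans (ltW dm') mb))
  (lt_le_trans hb3 (le_trans (ltW dm') mb)) (le_ball (le_trans (ltW dm') mb) hY).
set s := `|b2| + `|b3| in e2 e3 hG *.
have s0 : 0 <= s by rewrite addr_ge0.
have hY' : ball U0 m Y := le_ball (ltW dm') hY.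
have hGY : ball U0 m (G23 b3 b2 Y).
  apply/normr_ball; rewrite -(subrKA Y) (splitr m) (le_lt_trans (ler_normD _ _))//.
  rewrite ler_ltD//; last first.
    by rewrite (lt_le_trans _ dm)//; exact/normr_ball.
  apply: (le_trans hG); rewrite mulrC -ler_pdivlMr//.
  have : s <= d + d by rewrite lerD// ltW.
  move/le_trans; apply; apply: (@le_trans _ _ (m / (4 * Cb) + m / (4 * Cb))).
    by rewrite lerD// ge_min lexx orbT.
  by suff -> : m / (4 * Cb) + m / (4 * Cb) = m / 2 / Cb by []; field; rewrite gt_eqF.
have bz X (t : R) : ball U0 m X -> 0 <= t <= 1 ->
    ball (0, U0) m ((0, X) + t *: (a, 0) : R * state).
  move=> bX /andP[t0 t1]; split => /=; last by rewrite scaler0 addr0.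
  apply/normr_ball; rewrite subr0 add0r normrM (ger0_norm t0).
  by rewrite (le_lt_trans _ (lt_trans ha dm'))// ler_piMl.
have lin1 z : 'd f z (a, 0) = a *: g z.
  rewrite gE -linearZ; congr ('d f z _); apply/pair_equal_spec.
  by split; rewrite /= ?scaler0// [_%:A]mulr1.
have dP X (t : R) i : ball U0 m X -> 0 <= t <= 1 ->
    is_derive t 1 (fun t : R => Phi (t * a) X 0 i) (a * g ((0, X) + t *: (a, 0)) 0 i).
  move=> bX t01.
  have df : differentiable f ((0, X) + t *: (a, 0)).
    by apply: (C1 _ _).1; exact: le_ball mr _ (bz _ _ bX t01).
  have h := is_derive_coord i (is_derive_line df).
  have -> : (fun s : R => Phi (s * a) X 0 i) =
      (fun s => f ((0, X) + s *: (a, 0)) 0 i).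
    by apply/funext => t'; rewrite /f/= add0r scaler0 addr0.
  by apply: (is_derive_eq h); rewrite lin1 mxE.
apply: norm_le_coord => [|i]; first by apply: mulr_ge0; [exact: ltW|exact: mulr_ge0].
rewrite mxE [X in _ + X]mxE G23_coord.
set k := mkstate _ _ _ _ 0 i.
have hk : `|k - 1| <= Cb * s.
  rewrite /k; move: i @k; elim/ord4_ind; rewrite !mxE !inordK//=.
  by rewrite subrr normr0 mulr_ge0// ltW.
pose phi (t : R) := k * Phi (t * a) Y 0 i - Phi (t * a) (G23 b3 b2 Y) 0 i.
have -> : k * Phi a Y 0 i - Phi a (G23 b3 b2 Y) 0 i = phi 1 - phi 0.
  rewrite /phi !mul1r !mul0r (P0 _ (le_ball mr hY')).1 (P0 _ (le_ball mr hGY)).1.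
  by rewrite G23_coord subrr subr0.
apply: (@mean_value_bound _ _ (fun t : R => k * (a * g ((0, Y) + t *: (a, 0)) 0 i) -
   a * g ((0, G23 b3 b2 Y) + t *: (a, 0)) 0 i)).
  move=> t t01; have h1 := dP _ _ i hY' t01; have h2 := dP _ _ i hGY t01.
  have := is_deriveB (is_derive_mul (is_derive_cst k t 1) h1) h2.
  by move=> /is_derive_eq; apply; rewrite mul0r add0r.
move=> t t01.
set z1 := (0, Y) + _; set z2 := (0, G23 _ _ Y) + _.
have b1 : ball (0, U0) dg z1 := le_ball mg (bz _ _ hY' t01).
have b2' : ball (0, U0) dg z2 := le_ball mg (bz _ _ hGY t01).
have -> : k * (a * g z1 0 i) - a * g z2 0 i =
  a * ((k - 1) * g z1 0 i + (g z1 - g z2) 0 i) by rewrite !mxE; ring.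
have -> : (Cb * M + Cg * Cb) * (`|a| * s) = `|a| * (Cb * s * M + Cg * (Cb * s)).
  by ring.
rewrite normrM.
rewrite ler_wpM2l// (le_trans (ler_normD _ _))// lerD//.
  rewrite normrM ler_pM// (le_trans (coord_le_norm _ _))//.
  rewrite -(subrK (g (0, U0)) (g z1)) (le_trans (ler_normD _ _))// addrC lerD//.
  apply: (le_trans (hg _ _ b1 (ballxx _ dg0))).
  rewrite ler_pM2l// ltW//; apply/normr_ball; exact: bz.
rewrite (le_trans (coord_le_norm _ _))// (le_trans (hg _ _ b1 b2'))// ler_pM2l//.
apply: le_trans hG; rewrite /z1 /z2 opprD addrACA subrr addr0.
by rewrite prod_normE/= subrr normr0 distrC (max_idPr _).
Qed.

End Interaction.

(** The choice of q gives q <= 1 / 6, so q x is absorbed on the left of the first bound. Inserted in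
    the second, that bound costs q (2 A + 2) b <= (1 - k) / 2 b, which keeps the coefficient of b
    below 1. *)
Lemma absorb_small_terms (R : realType) (x x4 b A k q T : R) :
  0 <= x -> 0 <= b -> 0 <= A -> 0 <= k < 1 -> 0 <= T ->
  q * (2 * A + 3) = (1 - k) / 2 ->
  x <= A * b + q * (x + b) + T -> x4 <= k * b + q * (x + b) + T ->
  x <= (2 * A + 1) * b + 2 * T /\ x4 <= (1 + k) / 2 * b + 2 * T.
Proof.
move=> x0 b0 A0 /andP[k0 k1] T0 hq hx hx4.
have q0 : 0 <= q.
  have A3 : 0 < 2 * A + 3 by lra.
  by rewrite -(pmulr_lge0 _ A3) hq; lra.
have qA : 0 <= q * A by rewrite mulr_ge0.
have q6 : q <= 1 / 6 by lra.
have qx : q * x <= 1 / 6 * x by rewrite ler_wpM2r.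
have qb : q * b <= 1 / 6 * b by rewrite ler_wpM2r.
have Ab : 0 <= A * b by rewrite mulr_ge0.
have hx' : x <= (2 * A + 1) * b + 2 * T by lra.
split => //.
have qx' : q * x <= q * ((2 * A + 1) * b + 2 * T) by rewrite ler_wpM2l.
have qT : q * T <= 1 / 6 * T by rewrite ler_wpM2r.
have hqb : q * (2 * A + 3) * b = (1 - k) / 2 * b by rewrite hq.
have qb0 : 0 <= q * b by rewrite mulr_ge0.
lra.
Qed.

(** * Weak waves hitting the strong discontinuity from above *)

Lemma lax_curve0 (R : realType) (gamma : R) j Phi U0 :
  lax_curve gamma j Phi U0 ->
  exists2 r : R, 0 < r & forall U, ball U0 r U -> Phi 0 U = U.
Proof. by case=> r r0 [_ P0 _ _ _]; exists r => // U /P0[]. Qed.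

Unset Implicit Arguments.
Set Strict Implicit.

Theorem proposition4p3 (R : realType) (gamma : R)
    (Phi1 Phi4 : R -> 'rV[R]_4 -> 'rV[R]_4)
    (um1 pm1 rhom1 um2 pm2 rhom2 s20 s30 : R) :
  let Um1 := mkstate um1 0 pm1 rhom1 in
  let Um2 := mkstate um2 0 pm2 rhom2 in
  1 < gamma ->
  supersonic gamma Um1 -> supersonic gamma Um2 ->
  Um2 = G23 s30 s20 Um1 ->
  lax_curve gamma 1 Phi1 Um1 -> lax_curve gamma 1 Phi1 Um2 ->
  lax_curve gamma 4 Phi4 Um1 -> lax_curve gamma 4 Phi4 Um2 ->
  exists eta0 M : R, [/\ 0 < eta0, 0 < M &
  forall eta : R, 0 < eta <= eta0 ->
  exists2 eps : R, 0 < eps &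
  forall (U1 U2 U3 : 'rV[R]_4) (s2 s3 a4 b1 b2 b3 : R),
    ball Um1 eps U1 -> ball Um2 eps U2 -> ball Um2 eps U3 ->
    strong_waves Phi1 Phi4 s20 s30 eta U1 U2 0 s2 s3 a4 ->
    weak_waves Phi1 Phi4 eta U2 U3 b1 b2 b3 0 ->
    let Delta := `|a4| * (`|b2| + `|b3|) in
    exists d1 s2' s3' d4 : R,
      strong_waves Phi1 Phi4 s20 s30 eta U1 U3 d1 s2' s3' d4 /\
      exists K1 K2 K3 K4 : R,
        [/\ eq_upto M Delta d1 (K1 * b1),
            eq_upto M Delta s2' (s2 + b2 + K2 * b1),
            eq_upto M Delta s3' (s3 + b3 + K3 * b1),
            eq_upto M Delta d4 (a4 + K4 * b1) &
            `|K1| + `|K2| + `|K3| <= M /\ `|K4| < 1]].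
Proof.
move=> Um1 Um2 g1 ss1 ss2 U2E lc11 lc12 _ lc42.
pose d0 := mkstate 0 s20 s30 0.
have [d00 d01 d02 d03] : [/\ ucomp d0 = 0, vcomp d0 = s20, pcomp d0 = s30
  & rhocomp d0 = 0] by rewrite /d0 !mkstateE.
have [k1 [P1 [k10 P10 rE1]]] := rvec_background g1 ss1.
have [k2 [P2 [k20 P20 rE2]]] := rvec_background g1 ss2.
have [p10 rho10 cu1] := ss1.
have [B [uB LB kap1]] : exists B : 'M[R]_4, [/\ B \in unitmx,
    forall w : 'rV[R]_4, rhocomp w *: rvec gamma 4 Um2 +
      dG23 s30 s20 Um1 (pcomp w) (vcomp w) (ucomp w *: rvec gamma 1 Um1 + 0) = w *m B &
    `|rhocomp (rvec gamma 1 Um2 *m invmx B)| < 1].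
  apply: (@reflection_matrix R s30 s20 k1 P1 k2 P2) => //.
  - by apply: le_lt_trans cu1; exact: sqrtr_ge0.
  - exact: vcomp_mkstate.
  - by case: (rE1 1%N).
  - by case: (rE1 1%N) => _ ->; rewrite expr1 mulN1r.
  - by case: (rE2 1%N).
  - by case: (rE2 1%N) => _ ->; rewrite expr1 mulN1r.
  - by case: (rE2 4%N).
  - by case: (rE2 4%N) => _ ->; rewrite -signr_odd expr0 mul1r.
(* To first order, [kv] lists the changes of strength caused by a unit incoming 1-wave; its last
   entry is the reflection coefficient. *)
set kv := rvec gamma 1 Um2 *m invmx B in kap1.
have [C C0 hC] := mulmx_bounded (invmx B).
pose kap := `|rhocomp kv|; pose A := `|kv|.
have A0 : 0 <= A by exact: normr_ge0.
have A3 : 0 < 2 * A + 3 by rewrite ltr_wpDl// mulr_ge0.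
(* C e will be the q of [absorb_small_terms]; the gap 1 - kap pays for the errors. *)
have [e e0 Ce] : exists2 e : R, 0 < e & C * e * (2 * A + 3) = (1 - kap) / 2.
  exists ((1 - kap) / (2 * (2 * A + 3)) / C).
    by rewrite divr_gt0// divr_gt0 ?subr_gt0// mulr_gt0.
  by field; rewrite !gt_eqF.
pose F (z : 'rV[R]_4 * 'rV[R]_4) := Phi4 (rhocomp z.1)
  (G23 (pcomp z.1) (vcomp z.1) (Phi1 (ucomp z.1) z.2)).
have sF : strict_deriv F (d0, Um1) (fun v => rhocomp v.1 *: rvec gamma 4 Um2 +
       dG23 s30 s20 Um1 (pcomp v.1) (vcomp v.1)
       (ucomp v.1 *: rvec gamma 1 Um1 + v.2)).
  have := @strict_full R gamma 1 4 Phi1 Phi4 Um1 d0 lc11 d00 d03.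
  by rewrite d01 d02 -U2E; apply.
(* H composes the weak waves above the front; their 4-strength is 0. *)
pose H (z : 'rV[R]_4 * 'rV[R]_4) :=
  G23 (pcomp z.1) (vcomp z.1) (Phi1 (ucomp z.1) z.2).
have sH : strict_deriv H (0, Um2) (fun v =>
    dG23 0 0 Um2 (pcomp v.1) (vcomp v.1) (ucomp v.1 *: rvec gamma 1 Um2 + v.2)).
  have := @strict_front R gamma 1 Phi1 Um2 0 lc12.
  by rewrite mkstate0 !mkstateE; apply.
have sG : strict_deriv
    (fun z : 'rV[R]_4 * 'rV[R]_4 => G23 (pcomp z.1) (vcomp z.1) z.2)
    (d0, Um1) (fun v => dG23 (pcomp d0) (vcomp d0) Um1
      (pcomp v.1) (vcomp v.1) v.2) := strict_deriv_G23
    (strict_deriv_comp (strict_deriv_fst (d0, Um1)) (strict_deriv_coord d0 (inord 2)))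
    (strict_deriv_comp (strict_deriv_fst (d0, Um1)) (strict_deriv_coord d0 (inord 1)))
    (strict_deriv_snd (d0, Um1)).
have [dF dF0 hF] := sF.2 e e0.
have [dH dH0 hH] := sH.2 e e0.
have [Cc [dc [Cc0 dc0 hc]]] := lax_curve_commutator lc42.
have [dG dG0 hG] := strict_deriv_near sG dc0.
have [r1 r10 hr1] := lax_curve0 lc11.
have [r4 r40 hr4] := lax_curve0 lc42.
have [dX dX0 hX] := strict_deriv_near sH r40.
have [r1' r1'0 hr1'] := lax_curve0 lc12.
have [m m0 [mF mH mc mG [m1 mX m1']]] : exists2 m : R, 0 < m &
    [/\ m <= dF, m <= dH, m <= dc, m <= dG & [/\ m <= r1, m <= dX & m <= r1']].
  exists (\big[Num.min/1]_(x <- [:: dF; dH; dc; dG; r1; dX; r1']) x).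
    by rewrite !big_cons big_nil !lt_min dF0 dH0 dc0 dG0 r10 dX0 r1'0 ltr01.
  by rewrite !big_cons big_nil; do !split; rewrite !ge_min lexx ?orbT.
pose Kb := 2 * A + 1; pose Cd := 2 * (C * Cc).
have Kb0 : 0 <= Kb by rewrite addr_ge0// mulr_ge0.
have Cd0 : 0 <= Cd by rewrite !mulr_ge0// ltW.
(* Half of m, because s2 + b2 and s3 + b3 each combine two deviations below eta. M sums the bounds
   Kb of three coefficients and the O(1) constant Cd. *)
exists (m / 2), (3 * Kb + Cd + 1); split.
- by rewrite divr_gt0.
- by rewrite ltr_wpDl// addr_ge0// mulr_ge0.
move=> eta /andP[eta0 etam].
have [eps eps0 heps] := strict_deriv_solve sF LB uB eta0.
have FE : F (d0, Um1) = Um2.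
  rewrite /F/= d00 d01 d02 d03 (hr1 _ (ballxx _ r10)) -U2E.
  exact: hr4 (ballxx _ r40).
exists (Num.min eps m); first by rewrite lt_min eps0.
move=> U1 U2 U3 s2 s3 a4 b1 b2 b3 hU1 hU2 hU3.
have [bU1 bU1m] : ball Um1 eps U1 /\ ball Um1 m U1.
  by split; apply: le_ball hU1; rewrite ge_min lexx ?orbT.
have bU2 : ball Um2 m U2 by apply: le_ball hU2; rewrite ge_min lexx ?orbT.
have bU3 : ball Um2 eps U3 by apply: le_ball hU3; rewrite ge_min lexx ?orbT.
have etam' : eta < m by rewrite (le_lt_trans etam)// ltr_pdivrMr// ltr_pMr// ltr1n.
move=> [_ hs2 hs3 ha4 U2eq] [hb1 hb2 hb3 _ U3eq] Delta.
have Delta0 : 0 <= Delta by rewrite mulr_ge0// addr_ge0.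
have [d' bd' Fd'] := heps U1 U3 bU1 ltac:(by rewrite FE).
have /ballP[hd0 hd1 hd2 hd3] := bd'.
rewrite d00 subr0 in hd0; rewrite d01 in hd1; rewrite d02 in hd2.
rewrite d03 subr0 in hd3.
(* The guess superposes all waves but the 1-wave; [bb 0] is the weak data with the 1-wave
   removed. *)
pose ds := mkstate 0 (s2 + b2) (s3 + b3) a4.
pose bb t := mkstate t b2 b3 0.
pose Y := G23 s3 s2 U1.
have P0U1 : Phi1 0 U1 = U1 by apply: hr1; exact: le_ball bU1m.
have P0U2 : Phi1 0 U2 = U2 by apply: hr1'; exact: le_ball bU2.
have {}U2eq : U2 = Phi4 a4 Y by rewrite U2eq P0U1.
have bbb t : `|t| < eta -> ball (0, Um2) m (bb t, U2).
  move=> ht; split=> //=; apply/ballP; rewrite mkstate0 /bb !mkstateE !subr0 normr0.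
  by split=> //; exact: lt_trans etam'.
have {}U3eq : U3 = H (bb b1, U2).
  rewrite /H/= /bb !mkstateE; rewrite U3eq; apply: hr4.
  have := hX (bb b1, U2) (le_ball mX (bbb _ hb1)).
  rewrite /H/= /bb !mkstateE mkstate0 !mkstateE.
  by rewrite (hr1' _ (ballxx _ r1'0)) G23_0.
(* Without the 1-wave, the true state and the guess differ only in the order of Phi4 and G23, that
   is by the commutator. *)
have H0 : H (bb 0, U2) = G23 b3 b2 (Phi4 a4 Y).
  by rewrite /H/= /bb !mkstateE P0U2 U2eq.
have Fds : F (ds, U1) = Phi4 a4 (G23 b3 b2 Y).
  by rewrite /F/= /ds !mkstateE P0U1 /Y G23_add.
have bds : ball (d0, Um1) dF (ds, U1).
  split=> /=; last exact: le_ball bU1m.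
  apply: le_ball mF _ _; apply/ballP; rewrite d00 d01 d02 d03.
  rewrite /ds !mkstateE !subr0 normr0.
  split=> //; last exact: lt_trans etam'.
  - rewrite addrAC (splitr m) (le_lt_trans (ler_normD _ _))// ltrD//;
    exact: lt_le_trans etam.
  - rewrite addrAC (splitr m) (le_lt_trans (ler_normD _ _))// ltrD//;
    exact: lt_le_trans etam.
have bd'F : ball (d0, Um1) dF (d', U1).
  split=> /=; last exact: le_ball bU1m.
  by apply: le_ball bd'; apply: le_trans mF; exact: ltW.
have bY : ball Um2 dc Y.
  have := hG (mkstate 0 s2 s3 0, U1).
  rewrite /= !mkstateE -U2E; apply; split=> /=; last exact: le_ball bU1m.
  apply: le_ball mG _ _; apply/ballP; rewrite d00 d01 d02 d03.
  rewrite !mkstateE subr0 normr0.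
  by split=> //; exact: lt_trans etam'.
have etac (x : R) : `|x| < eta -> `|x| < dc.
  by move=> /lt_trans; apply; exact: lt_le_trans mc.
have N := hc a4 b2 b3 Y (etac _ ha4) (etac _ hb2) (etac _ hb3) bY.
(* [E1] compares the solution with the guess under F; [E2] compares the weak waves with and without
   the 1-wave under H. *)
have E1 := hF _ _ bd'F bds.
have E2 := hH _ _ (le_ball mH (bbb b1 hb1))
  (le_ball mH (bbb 0 ltac:(by rewrite normr0))).
set D := d' - ds.
have pE1 : (d', U1) - (ds, U1) = (D, 0) by congr (_, _); rewrite subrr.
have pE2 : (bb b1, U2) - (bb 0, U2) = (mkstate b1 0 0 0, 0).
  congr (_, _); last by rewrite subrr.
  rewrite addrC -scaleN1r; apply: state_eqP;
    rewrite comp_linE /bb !mkstateE; ring.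
rewrite pE1 LB Fd' U3eq Fds in E1.
rewrite pE2 H0 /= !mkstateE in E2.
have dGE : dG23 0 0 Um2 0 0 (b1 *: rvec gamma 1 Um2 + 0) = b1 *: rvec gamma 1 Um2.
  apply: state_eqP; rewrite addr0 /dG23 !mkstateE ?expR0; ring.
rewrite dGE in E2.
have n1 : `|(D, 0 : 'rV[R]_4)| = `|D|.
  by rewrite prod_normE/= normr0; apply/max_idPl.
have n2 : `|(mkstate b1 0 0 0, 0 : 'rV[R]_4)| <= `|b1|.
  rewrite prod_normE/= ge_max normr0 normr_ge0 andbT.
  by apply: norm_le_comp; rewrite ?mkstateE ?normr0.
rewrite n1 in E1.
set X1 := _ - _ - _ *m _ in E1; set X2 := _ - _ - _ *: _ in E2.
set X3 := _ - _ in N.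
(* D B = b1 r1' + o(|b1|) + o(|D|) + commutator, solved for D. *)
have DE : D = b1 *: kv + (X2 - X1 + X3) *m invmx B.
  rewrite -[LHS](mulmxK uB) /kv scalemxAl -mulmxDl; congr (_ *m _).
  have aux (P Q S x y : 'rV[R]_4) :
      x = y + (P - S - y - (P - Q - x) + (S - Q)).
    by apply/rowP => i; rewrite !mxE; ring.
  exact: aux.
have X123 : `|X2 - X1 + X3| <= e * (`|D| + `|b1|) + Cc * Delta.
  rewrite (le_trans (ler_normD _ _))// lerD// (le_trans (ler_normB _ _))//.
  rewrite mulrDr addrC lerD// (le_trans E2)// ler_pM2l//.
have bnd : `|(X2 - X1 + X3) *m invmx B| <= C * e * (`|D| + `|b1|) + C * Cc * Delta.
  rewrite (le_trans (hC _))//.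
  have -> : C * e * (`|D| + `|b1|) + C * Cc * Delta =
    C * (e * (`|D| + `|b1|) + Cc * Delta).
    by rewrite [RHS]mulrDr (mulrA C e) (mulrA C Cc).
  by rewrite ler_pM2l.
(* The 4-strength keeps the sharp factor kap instead of A. *)
have D3 : `|rhocomp D| <= kap * `|b1| + C * e * (`|D| + `|b1|) + C * Cc * Delta.
  rewrite {1}DE comp_linE (le_trans (ler_normD _ _))// -[leRHS]addrA lerD//.
    by rewrite normrM mulrC -/kap.
  exact: le_trans (coord_le_norm _ _) bnd.
have D0 : `|D| <= A * `|b1| + C * e * (`|D| + `|b1|) + C * Cc * Delta.
  rewrite {1}DE (le_trans (ler_normD _ _))// -[leRHS]addrA lerD//.
  by rewrite normrZ mulrC -/A.
have T0 : 0 <= C * Cc * Delta by rewrite mulr_ge0 ?(ltW (mulr_gt0 C0 Cc0)).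
have kap01 : 0 <= kap < 1 by rewrite normr_ge0.
have [Dle D3le] := absorb_small_terms (normr_ge0 D) (normr_ge0 b1) A0
   kap01 T0 Ce D0 D3.
have CdE : 2 * (C * Cc * Delta) = Cd * Delta by rewrite /Cd (mulrA 2).
rewrite CdE in Dle D3le.
have Dc i : `|d' 0 i - ds 0 i| <= Kb * `|b1| + Cd * Delta.
  by apply: le_trans Dle; have := coord_le_norm D i; rewrite mxE [X in _ + X]mxE.
have kap0 : 0 <= (1 + kap) / 2.
  by case/andP: kap01 => k0 _; rewrite divr_ge0// addr_ge0.
have D0' : `|ucomp d' - 0| <= Kb * `|b1| + Cd * Delta.
  by have := Dc (inord 0); rewrite -!/(ucomp _) /ds mkstateE.
have D1' : `|vcomp d' - (s2 + b2)| <= Kb * `|b1| + Cd * Delta.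
  by have := Dc (inord 1); rewrite -!/(vcomp _) /ds mkstateE.
have D2' : `|pcomp d' - (s3 + b3)| <= Kb * `|b1| + Cd * Delta.
  by have := Dc (inord 2); rewrite -!/(pcomp _) /ds mkstateE.
have D3' : `|rhocomp d' - a4| <= (1 + kap) / 2 * `|b1| + Cd * Delta.
  move: D3le; rewrite /D addrC -scaleN1r comp_linE /ds mkstateE.
  by rewrite mulN1r addrC.
(* The first three coefficients are bounded by Kb, the last by (1 + kap) / 2, the midpoint of kap
   and 1. *)
have [K1 K1le o1] := split_linear_bound Kb0 Cd0 Delta0 D0'.
have [K2 K2le o2] := split_linear_bound Kb0 Cd0 Delta0 D1'.
have [K3 K3le o3] := split_linear_bound Kb0 Cd0 Delta0 D2'.
have [K4 K4le o4] := split_linear_bound kap0 Cd0 Delta0 D3'.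
exists (ucomp d'), (vcomp d'), (pcomp d'), (rhocomp d'); split.
  by split=> //; rewrite -Fd'.
have ME : 3 * Kb + Cd + 1 = Kb + Kb + Kb + (Cd + 1) by ring.
have CdM : Cd <= 3 * Kb + Cd + 1 by rewrite addrAC lerDr addr_ge0// mulr_ge0.
have upto x y : eq_upto Cd Delta x y -> eq_upto (3 * Kb + Cd + 1) Delta x y.
  by move=> [w wle xy]; exists w => //; exact: le_trans CdM.
exists K1, K2, K3, K4; split; try exact: upto.
  by apply: upto; move: o1; rewrite add0r.
split; first by rewrite ME ler_wpDr ?addr_ge0// !lerD.
rewrite (le_lt_trans K4le)// ltr_pdivrMr// mul1r -natr1 addrC ltrD2r.
by case/andP: kap01.
Qed.
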